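(* Let $(G,V)$ be a multiplicity free space. Set $\mathcal{O}=\{x\in V\,|\,\Delta_i(x)\neq0,\ i=0,\dots,k\}$. Then $D(V)^G=D(\mathcal{O})^G$. In other words, any $G$-invariant differential operator with coefficients in $\mathbb{C}[\mathcal{O}]$ has in fact polynomial coefficients.
   Context: Let $G$ be a connected reductive algebraic group over $\mathbb{C}$ and $V$ a finite-dimensional rational representation. $G$ acts on $\mathbb{C}[V]$ by $(g.\varphi)(x)=\varphi(g^{-1}x)$. $(G,V)$ is multiplicity free if each irreducible representation of $G$ occurs at most once in $\mathbb{C}[V]$; then $G$ has a Zariski open orbit in $V$. $\Delta_0,\dots,\Delta_k$ denote the fundamental relative invariants of $(G,V)$: the irreducible polynomials (unique up to nonzero scalars) which define the codimension-one irreducible components of the complement of the open $G$-orbit. They are relatively invariant ($\Delta_i(g.x)=\chi_i(g)\Delta_i(x)$ for a character $\chi_i$ of $G$), and every nonzero rational relative invariant of $G$ is uniquely of the form $c\Delta_0^{n_0}\cdots\Delta_k^{n_k}$, $c\in\mathbb{C}^*$, $n_i\in\mathbb{Z}$. The open set $\mathcal{O}$ is $G$-stable; $\mathbb{C}[\mathcal{O}]$ is the ring of regular functions on $\mathcal{O}$ (rational functions whose denominators are monomials in $\Delta_0,\dots,\Delta_k$). $D(V)$ (resp. $D(\mathcal{O})$) is the algebra of differential operators with coefficients in $\mathbb{C}[V]$ (resp. $\mathbb{C}[\mathcal{O}]$), with $G$ acting by $(g.D)(\varphi)=g.(D(g^{-1}.\varphi))$. *)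

(* Defs.v *)
From mathcomp Require Import all_boot all_order all_algebra.
From mathcomp Require Export boolp classical_sets functions reals.
From mathcomp Require Export complex.
From mathcomp Require Export mpoly.

Set Implicit Arguments.
Unset Strict Implicit.
Unset Printing Implicit Defensive.

Import GRing.Theory.
Local Open Scope classical_set_scope.
Local Open Scope ring_scope.

(* [crd] sends a point of an affine space [T] to its [N] coordinates. *)
Definition zclosed (F : fieldType) (T : Type) (N : nat)
    (crd : T -> 'I_N -> F) (A : set T) : Prop :=
  exists S : set {mpoly F[N]},
    A = [set x | forall p, S p -> p.@[crd x] = 0].

Definition mx_crd (F : fieldType) (n : nat) (A : 'M[F]_n) : 'I_(n * n) -> F :=
  fun k => mxvec A 0 k.

Definition vec_crd (F : fieldType) (m : nat) (x : 'cV[F]_m) : 'I_m -> F :=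
  fun i => x i 0.

Definition mx_closed (F : fieldType) (n : nat) (A : set 'M[F]_n) : Prop :=
  zclosed (@mx_crd F n) A.

Definition vec_closed (F : fieldType) (m : nat) (A : set 'cV[F]_m) : Prop :=
  zclosed (@vec_crd F m) A.

Definition vec_open (F : fieldType) (m : nat) (A : set 'cV[F]_m) : Prop :=
  vec_closed (~` A).

Definition vec_irreducible (F : fieldType) (m : nat) (Z : set 'cV[F]_m) :
    Prop :=
  Z !=set0 /\
  forall A B, vec_closed A -> vec_closed B ->
    Z `<=` A `|` B -> Z `<=` A \/ Z `<=` B.

Definition irreducible_component (F : fieldType) (m : nat)
    (S Z : set 'cV[F]_m) : Prop :=
  [/\ vec_closed Z, vec_irreducible Z, Z `<=` S
    & forall Y, vec_closed Y -> vec_irreducible Y -> Y `<=` S ->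
        Z `<=` Y -> Y = Z].

(* For an irreducible closed subset of the irreducible space F^m. *)
Definition codim_one (F : fieldType) (m : nat) (Z : set 'cV[F]_m) : Prop :=
  Z <> setT /\
  forall Y, vec_closed Y -> vec_irreducible Y -> Z `<=` Y ->
    Y = Z \/ Y = setT.

Definition algebraic_group (F : fieldType) (n : nat) (G : set 'M[F]_n) : Prop :=
  [/\ exists2 Z, mx_closed Z & G = [set g | g \in unitmx] `&` Z,
      G 1%:M,
      forall g h, G g -> G h -> G (g *m h)
    & forall g, G g -> G (invmx g)].

Definition zconnected (F : fieldType) (n : nat) (G : set 'M[F]_n) : Prop :=
  forall A B, mx_closed A -> mx_closed B ->
    G `<=` A `|` B -> G `&` A `&` B = set0 -> G `<=` A \/ G `<=` B.

Definition unipotent (F : fieldType) (n : nat) (U : set 'M[F]_n) : Prop :=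
  forall u, U u -> exists k : nat, (u - 1%:M) ^+ k = 0.

Definition normal_in (F : fieldType) (n : nat) (G U : set 'M[F]_n) : Prop :=
  U `<=` G /\ forall g u, G g -> U u -> U (g *m u *m invmx g).

(* The unipotent radical, i.e. the largest closed connected normal unipotent
   subgroup, is trivial. *)
Definition reductive (F : fieldType) (n : nat) (G : set 'M[F]_n) : Prop :=
  forall U, algebraic_group U -> normal_in G U -> zconnected U ->
    unipotent U -> U = [set 1%:M].

(* Regular functions on a closed subgroup of GL_n are the restrictions of the
   polynomials in the matrix entries and the inverse of the determinant. *)
Definition regular_on (F : fieldType) (n : nat) (G : set 'M[F]_n)
    (f : 'M[F]_n -> F) : Prop :=
  exists (p : {mpoly F[n * n]}) (k : nat),
    forall g, G g -> f g = p.@[mx_crd g] / (\det g) ^+ k.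

(* Only the values of [rho] on [G] matter; V is the space of columns F^m. *)
Definition rational_rep (F : fieldType) (n m : nat) (G : set 'M[F]_n)
    (rho : 'M[F]_n -> 'M[F]_m) : Prop :=
  [/\ rho 1%:M = 1%:M,
      forall g h, G g -> G h -> rho (g *m h) = rho g *m rho h
    & forall i j, regular_on G (fun g => rho g i j)].

(* (g.p)(x) = p(g^-1 x) *)
Definition poly_act (F : fieldType) (n m : nat) (rho : 'M[F]_n -> 'M[F]_m)
    (g : 'M[F]_n) (p : {mpoly F[m]}) : {mpoly F[m]} :=
  p \mPo [tuple \sum_(j < m) rho (invmx g) i j *: 'X_j | i < m].

Definition subrep (F : fieldType) (n m : nat) (G : set 'M[F]_n)
    (rho : 'M[F]_n -> 'M[F]_m) (U : set {mpoly F[m]}) : Prop :=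
  [/\ U 0,
      forall (a : F) p q, U p -> U q -> U (a *: p + q)
    & forall g p, G g -> U p -> U (poly_act rho g p)].

Definition irreducible_subrep (F : fieldType) (n m : nat) (G : set 'M[F]_n)
    (rho : 'M[F]_n -> 'M[F]_m) (U : set {mpoly F[m]}) : Prop :=
  [/\ subrep G rho U, U <> [set 0]
    & forall W, subrep G rho W -> W `<=` U -> W = [set 0] \/ W = U].

Definition subrep_iso (F : fieldType) (n m : nat) (G : set 'M[F]_n)
    (rho : 'M[F]_n -> 'M[F]_m) (U W : set {mpoly F[m]}) : Prop :=
  exists f : {mpoly F[m]} -> {mpoly F[m]},
    [/\ set_bij U W f,
        forall (a : F) p q, U p -> U q -> f (a *: p + q) = a *: f p + f q
      & forall g p, G g -> U p -> f (poly_act rho g p) = poly_act rho g (f p)].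

Definition direct_sum_decomposition (F : fieldType) (m : nat) (I : choiceType)
    (U : I -> set {mpoly F[m]}) : Prop :=
  (forall p, exists (s : seq I) (u : I -> {mpoly F[m]}),
     (forall i, U i (u i)) /\ p = \sum_(i <- s) u i) /\
  (forall (s : seq I) (u : I -> {mpoly F[m]}), uniq s ->
     (forall i, U i (u i)) -> \sum_(i <- s) u i = 0 ->
     forall i, i \in s -> u i = 0).

(* Over a field of characteristic 0, F[V] is a direct sum of irreducible
   representations when G is reductive; each isomorphism class of irreducible
   representations has to occur at most once among the summands. *)
Definition multiplicity_free (F : fieldType) (n m : nat) (G : set 'M[F]_n)
    (rho : 'M[F]_n -> 'M[F]_m) : Prop :=
  exists (I : choiceType) (U : I -> set {mpoly F[m]}),
    [/\ direct_sum_decomposition U,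
        forall i, irreducible_subrep G rho (U i)
      & forall i j, subrep_iso G rho (U i) (U j) -> i = j].

Definition orbit_of (F : fieldType) (n m : nat) (G : set 'M[F]_n)
    (rho : 'M[F]_n -> 'M[F]_m) (x : 'cV[F]_m) : set 'cV[F]_m :=
  [set rho g *m x | g in G].

(* The union of the Zariski open orbits.  As F^m is irreducible for F infinite,
   there is at most one such orbit. *)
Definition open_orbit (F : fieldType) (n m : nat) (G : set 'M[F]_n)
    (rho : 'M[F]_n -> 'M[F]_m) : set 'cV[F]_m :=
  [set x | vec_open (orbit_of G rho x)].

Definition zero_locus (F : fieldType) (m : nat) (p : {mpoly F[m]}) :
    set 'cV[F]_m :=
  [set x | p.@[vec_crd x] = 0].

Definition mpoly_irreducible (F : fieldType) (m : nat) (p : {mpoly F[m]}) :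
    Prop :=
  [/\ p != 0, p \isn't a GRing.unit
    & forall a b : {mpoly F[m]}, p = a * b ->
        a \is a GRing.unit \/ b \is a GRing.unit].

(* The empty family (r = 0) is allowed: the complement of the open orbit may
   have no component of codimension one. *)
Definition fundamental_relative_invariants (F : fieldType) (n m r : nat)
    (G : set 'M[F]_n) (rho : 'M[F]_n -> 'M[F]_m)
    (Delta : 'I_r -> {mpoly F[m]}) : Prop :=
  [/\ forall i, mpoly_irreducible (Delta i),
      injective (fun i => zero_locus (Delta i))
    & forall Z, (irreducible_component (~` open_orbit G rho) Z /\ codim_one Z)
        <-> exists i, Z = zero_locus (Delta i)].

(* The field of rational functions on F^m. *)
Notation ratfun F m := {fraction {mpoly F[m]}}.

Definition rat_of_poly (F : fieldType) (m : nat) (p : {mpoly F[m]}) :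
  ratfun F m := FracField.tofrac p.

(* [repr f] is some numerator/denominator pair representing [f]; the two
   definitions below do not depend on its choice. *)
Definition rat_act (F : fieldType) (n m : nat) (rho : 'M[F]_n -> 'M[F]_m)
    (g : 'M[F]_n) (f : ratfun F m) : ratfun F m :=
  rat_of_poly (poly_act rho g \n_(repr f)) /
  rat_of_poly (poly_act rho g \d_(repr f)).

Definition rat_deriv (F : fieldType) (m : nat) (i : 'I_m) (f : ratfun F m) :
    ratfun F m :=
  let p := \n_(repr f) in let q := \d_(repr f) in
  rat_of_poly (mderiv i p * q - p * mderiv i q) / rat_of_poly (q ^+ 2).

Definition rat_derivm (F : fieldType) (m : nat) (al : 'X_{1..m})
    (f : ratfun F m) : ratfun F m :=
  foldr (fun i h => iter (al i) (rat_deriv i) h) f (enum 'I_m).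

(* The differential operators with coefficients in [A].  The finitely supported
   family of coefficients [al |-> a_al] is encoded as the polynomial [a] with
   these coefficients, i.e. the symbol of the operator. *)
Definition diff_op (F : fieldType) (m : nat) (A : set (ratfun F m))
    (D : ratfun F m -> ratfun F m) : Prop :=
  exists a : {mpoly (ratfun F m)[m]},
    (forall al, A a@_al) /\
    (forall f, D f = \sum_(al <- msupp a) a@_al * rat_derivm al f).

(* The elements of [diff_op A] which are G-invariant as operators on [A].  They
   are viewed as operators on the whole field of rational functions in order to
   compare different rings [A]: such an operator is determined by its values
   on polynomials. *)
Definition invariant_diff_op (F : fieldType) (n m : nat) (G : set 'M[F]_n)
    (rho : 'M[F]_n -> 'M[F]_m) (A : set (ratfun F m)) :
    set (ratfun F m -> ratfun F m) :=
  [set D | diff_op A D /\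
    forall g f, G g -> A f -> rat_act rho g (D (rat_act rho (invmx g) f)) = D f].

(* F[V] *)
Definition polynomial_ring (F : fieldType) (m : nat) : set (ratfun F m) :=
  range (@rat_of_poly F m).

(* F[O], where O is the set of the points at which no [Delta i] vanishes. *)
Definition regular_ring (F : fieldType) (m r : nat)
    (Delta : 'I_r -> {mpoly F[m]}) : set (ratfun F m) :=
  [set f | exists (p : {mpoly F[m]}) (e : 'I_r -> nat),
     f = rat_of_poly p / rat_of_poly (\prod_(i < r) Delta i ^+ e i)].

(* Main.v *)
Require Import Defs.
From mathcomp Require Import all_boot all_order all_algebra ring.
From mathcomp Require Import boolp classical_sets functions reals complex mpoly.

(* A G-invariant operator D with coefficients in F[O] is multiplied by a
   relative invariant P, a product of powers of the Delta i, such that P D has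
   polynomial coefficients.  For an irreducible summand U of F[V] the maps
   p |-> P p and p |-> P (D p) from U to F[V] are equivariant up to the same
   character, so that their images are isomorphic (or the second one is zero),
   hence equal since F[V] is multiplicity free.  Thus D maps U into U, D
   preserves F[V], and its coefficients are polynomials.

   The Delta i are relative invariants because the connected group G cannot
   permute the components of the complement of the open orbit, and because an
   irreducible polynomial divides every polynomial vanishing on its zero locus.
   The latter is proved by induction on the number of variables: Gauss' lemma
   and a Bezout identity over the field of fractions of the coefficients.

   Conversely an operator invariant on F[V] is invariant on F[O], as a
   differential operator vanishing on F[V] is zero. *)

Set Implicit Arguments.
Unset Strict Implicit.
Unset Printing Implicit Defensive.

Import GRing.Theory.
Local Open Scope classical_set_scope.
Local Open Scope ring_scope.

(** * Gauss' lemma *)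

Definition divides (A : idomainType) (a b : A) : Prop := exists c, b = a * c.

Definition prime_elt (A : idomainType) (p : A) : Prop :=
  [/\ p != 0, p \isn't a GRing.unit
    & forall a b, divides p (a * b) -> divides p a \/ divides p b].

Definition irreducible_elt (A : idomainType) (p : A) : Prop :=
  [/\ p != 0, p \isn't a GRing.unit
    & forall a b, p = a * b -> a \is a GRing.unit \/ b \is a GRing.unit].

(** The factors are required to be prime rather than irreducible, which makes uniqueness of the
    factorization automatic. *)
Definition factorial_ring (A : idomainType) : Prop :=
  forall a : A, a != 0 ->
  exists (s : seq A) (u : A),
    [/\ forall p, p \in s -> prime_elt p, u \is a GRing.unit
      & a = u * \prod_(p <- s) p].

Section Gauss.

Variable A : idomainType.
Implicit Types (a b c p : A) (f g h : {poly A}).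

(** Split one prime off the factorization of [p]: irreducibility makes the cofactor a unit, so [p]
    is associate to that prime. *)
Lemma factorial_irreducible_prime p :
  factorial_ring A -> irreducible_elt p -> prime_elt p.
Proof.
move=> hA [p0 pu irr]; have [[|q s] [u [ps uu e]]] := hA p p0.
  by move: pu; rewrite e big_nil mulr1 uu.
have [q0 qu qp] := ps q (mem_head _ _).
rewrite big_cons mulrCA in e.
have [//|vu] := irr _ _ e; first by rewrite (negbTE qu).
split=> // a b [c ec].
have /qp : divides q (a * b).
  by exists (u * \prod_(p <- s) p * c); rewrite ec e -!mulrA.
rewrite {}e; case=> [[d ->]|[d ->]]; [left|right];
  by exists ((u * \prod_(p <- s) p)^-1 * d); rewrite -mulrA mulVKr.
Qed.

Lemma divides_polyC_coef c f :
  (forall i, divides c f`_i) -> divides c%:P f.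
Proof.
move=> /choice [w hw]; exists (\poly_(i < size f) w i); apply/polyP=> i.
rewrite coefCM coef_poly; case: ltnP => [_|le]; first exact: hw.
by rewrite nth_default // mulr0.
Qed.

(** Induction on the sum of the sizes. The prime [p] divides the product of the leading
    coefficients, hence one of them; removing that leading term lowers the size and does not affect
    divisibility by [p]. *)
Lemma prime_polyC p : prime_elt p -> prime_elt p%:P.
Proof.
case=> p0 pu pp; split; first by rewrite polyC_eq0.
  apply: contra pu => /unitrP [q [q1 q2]]; apply/unitrP; exists q`_0.
  have := congr1 (coefp 0) q1; have := congr1 (coefp 0) q2.
  by rewrite /= coefCM coefMC !coef1.
move=> f g; have [n] := ubnP (size f + size g)%N.
have main (k l : {poly A}) : divides p (lead_coef k * lead_coef l) ->
    divides p (lead_coef k) \/ divides p (lead_coef l) by exact: pp.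
elim: n => // n IH in f g *; rewrite ltnS => le [q e].
have [->|f0] := eqVneq f 0; first by left; exists 0; rewrite mulr0.
have [->|g0] := eqVneq g 0; first by right; exists 0; rewrite mulr0.
have split_lead (k : {poly A}) c : k != 0 -> lead_coef k = p * c ->
    exists2 k' : {poly A}, (size k' < size k)%N & k = k' + p%:P * (c *: 'X^((size k).-1)).
  move=> k0 kc; exists (k - lead_coef k *: 'X^((size k).-1)); last first.
    by rewrite mul_polyC scalerA -kc subrK.
  rewrite (polySpred k0) ltnS; apply/leq_sizeP => j hj.
  rewrite coefB coefZ coefXn; have [->|ne] := eqVneq j.
    by rewrite mulr1 lead_coefE subrr.
  rewrite mulr0 subr0; apply: nth_default; rewrite (polySpred k0).
  by rewrite ltn_neqAle eq_sym ne.
have /main : divides p (lead_coef f * lead_coef g).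
  by exists (lead_coef q); rewrite -lead_coefM e lead_coefM lead_coefC.
case=> [[c /(split_lead f c f0) [k lk ek]]|[c /(split_lead g c g0) [k lk ek]]].
  have [||[w ew]|[w ew]] := IH k g.
  - by apply: leq_trans le; rewrite ltn_add2r.
  - by exists (q - c *: 'X^((size f).-1) * g); rewrite mulrBr -e {1}ek mulrDl mulrA addrK.
  - left; exists (w + c *: 'X^((size f).-1)).
    by rewrite mulrDr -ew.
  - by right; exists w.
have [||[w ew]|[w ew]] := IH f k.
- by apply: leq_trans le; rewrite ltn_add2l.
- exists (q - c *: 'X^((size g).-1) * f).
  by rewrite mulrBr -e {1}ek mulrDr [f * (_ * _)]mulrCA [f * (_ *: _)]mulrC addrK.
- by left; exists w.
right; exists (w + c *: 'X^((size g).-1)).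
by rewrite mulrDr -ew.
Qed.

(** Each prime of the constant divides [g] or [q] and is cancelled there. A factorization of [f]
    over the field of fractions thus descends to [A] with the same degrees. *)
Lemma factor_primes_left f g q (s : seq A) (u : A) :
  (forall p, p \in s -> prime_elt p) -> u \is a GRing.unit ->
  (u * \prod_(p <- s) p)%:P * f = g * q ->
  exists g' q', [/\ f = g' * q', size g' = size g & size q' = size q].
Proof.
elim: s g q => [|p s IH] g q ps uu; rewrite ?(big_nil, big_cons, mulr1).
  move=> e; exists (u^-1%:P * g), q; split=> //.
    by rewrite -mulrA -e mulrA -polyCM mulVr // mul1r.
  by rewrite mul_polyC size_scale // invr_eq0; apply: contraTneq uu => ->; rewrite unitr0.
have pp := ps p (mem_head _ _); have [p0 _ pd] := prime_polyC pp.
have {}ps q' : q' \in s -> prime_elt q' by move=> h; apply: ps; rewrite inE h orbT.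
rewrite mulrCA polyCM -mulrA => e.
have : divides p%:P (g * q) by eexists; exact/esym/e.
have szC (a : {poly A}) : size (p%:P * a) = size a.
  by rewrite mul_polyC size_scale //; case: pp.
case/pd=> [[c ec]|[c ec]]; rewrite ec ?szC; apply: IH => //; apply: (mulfI p0).
  by rewrite e ec mulrA.
by rewrite e ec mulrCA.
Qed.

(** [dvdp] is divisibility up to a nonzero constant. A prime of that constant cannot divide [f],
    irreducible of positive degree, so it divides the cofactor and cancels. *)
Lemma dvdp_divides f h : factorial_ring A -> irreducible_elt f ->
  (1 < size f)%N -> Pdiv.Idomain.dvdp f h -> divides f h.
Proof.
move=> hA [f0 fu firr] sf /Pdiv.Idomain.dvdpP [[c q] /= c0].
have [s [u [ps uu ->]]] := hA c c0; rewrite -mul_polyC mulrC.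
elim: s q h ps => [|p s IH] q h ps; rewrite ?(big_nil, big_cons, mulr1).
  move=> e; exists (u^-1%:P * q).
  by rewrite mulrCA [f * q]mulrC -e mulrCA -polyCM mulVr // mulr1.
have pp := ps p (mem_head _ _); have [p0 pu pd] := prime_polyC pp.
have {}ps q' : q' \in s -> prime_elt q' by move=> h'; apply: ps; rewrite inE h' orbT.
rewrite mulrCA polyCM mulrCA => e.
have /pd : divides p%:P (q * f) by eexists; exact/esym/e.
case=> [[q' eq']|[f' ef]].
  by apply: (IH q' h ps); apply: (mulfI p0); rewrite e eq' mulrA.
case: (firr _ _ ef) => [|f'u]; first by rewrite (negbTE pu).
move: sf; rewrite ef mul_polyC size_scale; last by case: pp.
by move: f'u; rewrite poly_unitE => /andP[/eqP->].
Qed.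

(** If [f] and [h] are coprime over the field of fractions, clear denominators in a Bezout identity.
    Otherwise their gcd is a nonconstant divisor of [f] up to constants, so by irreducibility it is
    [f] itself up to constants. *)
Lemma irreducible_bezout f h : factorial_ring A -> irreducible_elt f ->
  (1 < size f)%N ->
  divides f h \/ exists u v r, r != 0 /\ u * f + v * h = r%:P.
Proof.
move=> hA irrf sf; have [f0 fu firr] := irrf.
have [cop|ncop] := boolP (Pdiv.Idomain.coprimep f h).
  right; have /Pdiv.Idomain.Bezout_coprimepP [[u v] /= e] := cop.
  have /Pdiv.Idomain.eqpP [[c d] /= /andP[c0 d0] ecd] := e.
  exists (c *: u), (c *: v), d; split=> //.
  by rewrite -!scalerAl -scalerDr ecd alg_polyC.
left; set d := Pdiv.Idomain.gcdp f h.
have [[c q] /= c0 ec] := Pdiv.Idomain.dvdpP _ _ (Pdiv.Idomain.dvdp_gcdl f h).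
have [s [u [ps uu cs]]] := hA c c0.
have [|g' [q' [e' sg sq]]] := @factor_primes_left f d q s u ps uu.
  by rewrite -cs mul_polyC ec mulrC.
have [g'u|q'u] := firr _ _ e'.
  case/negP: ncop; rewrite Pdiv.Idomain.coprimep_def -/d -sg.
  by move: g'u; rewrite poly_unitE => /andP[].
apply: dvdp_divides => //.
apply: Pdiv.Idomain.dvdp_trans (Pdiv.Idomain.dvdp_gcdr f h).
have -> : Pdiv.Idomain.dvdp f (Pdiv.Idomain.gcdp f h) =
  Pdiv.Idomain.eqp (Pdiv.Idomain.gcdp f h) f.
  by rewrite /Pdiv.Idomain.eqp Pdiv.Idomain.dvdp_gcdl.
rewrite -Pdiv.Idomain.dvdp_size_eqp ?Pdiv.Idomain.dvdp_gcdl // -/d -sg.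
apply/eqP; move: q'u; rewrite poly_unitE => /andP[/size_poly1P[a a0 ea] _].
by rewrite e' ea mulrC mul_polyC size_scale.
Qed.

Lemma irreducible_polyC (c : A) :
  irreducible_elt c%:P -> irreducible_elt c.
Proof.
case=> c0 cu cirr; split.
- by rewrite -polyC_eq0.
- by apply: contra cu => cu; exact: rmorph_unit.
have unitC (a : A) : a%:P \is a GRing.unit -> a \is a GRing.unit.
  by rewrite poly_unitE coefC => /andP[].
by move=> a b e; have [|/unitC|/unitC] := cirr a%:P b%:P; rewrite -?polyCM -?e; auto.
Qed.

(** For nonconstant [f] dividing [g * h] but not [g], multiplying a Bezout identity for [f] and [g]
    by [h] shows that [f] divides a nonzero constant multiple of [h]. *)
Lemma irreducible_poly_prime f :
  factorial_ring A -> irreducible_elt f -> prime_elt f.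
Proof.
move=> hA irrf; have [f0 fu firr] := irrf.
have [sf|sf] := leqP (size f) 1.
  have ef := size1_polyC sf; rewrite ef in irrf *.
  apply: prime_polyC; apply: factorial_irreducible_prime => //.
  exact: irreducible_polyC.
split=> // g h [q e].
have [|[u [v [r [r0 euv]]]]] := irreducible_bezout g hA irrf sf; first by left.
right; apply: dvdp_divides => //; apply/Pdiv.Idomain.dvdpP.
exists (r, u * h + v * q) => //=.
by rewrite -mul_polyC -euv !mulrDl -!mulrA e [f * q]mulrC [f * h]mulrC.
Qed.

End Gauss.

(** * Polynomials in n+1 variables as univariate polynomials in the last one *)

Section LastVariable.

Variables (R : comNzRingType) (n : nat).
Implicit Types (P Q : {poly {mpoly R[n]}}) (p : {mpoly R[n.+1]}).

(** This is the inverse of [muni], as [muniK] and [of_muniK] show. *)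
Definition of_muni P : {mpoly R[n.+1]} := (map_poly (@mwiden n R) P).['X_ord_max].

Lemma of_muniD : {morph of_muni : P Q / P + Q}.
Proof. by move=> P Q; rewrite /of_muni rmorphD hornerD. Qed.

Lemma of_muni0 : of_muni 0 = 0.
Proof. by rewrite /of_muni rmorph0 horner0. Qed.

Lemma of_muniM : {morph of_muni : P Q / P * Q}.
Proof. by move=> P Q; rewrite /of_muni rmorphM hornerM. Qed.

Lemma of_muni1 : of_muni 1 = 1.
Proof. by rewrite /of_muni rmorph1 hornerC. Qed.

Lemma muniX (m : 'X_{1..n.+1}) : muni ('X_[m] : {mpoly R[n.+1]}) =
  'X_[[multinom (m (widen_ord (leqnSn n) i)) | i < n]] *: 'X^(m ord_max).
Proof. by rewrite muniE msuppX big_seq1 mcoeffX eqxx scale1r. Qed.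

Lemma muniK : cancel (@muni n R) of_muni.
Proof.
move=> p; rewrite muniE (big_morph _ of_muniD of_muni0) [RHS]mpolyE.
apply: eq_bigr => m _; rewrite /of_muni -mul_polyC rmorphM /= map_polyC /=.
rewrite map_polyXn hornerM hornerC hornerXn mwidenZ mwidenX -scalerAl.
congr (_ *: _); rewrite mpolyXn -mpolyXD; congr 'X_[_].
apply/mnmP => i; rewrite mnmDE mulmnE mnm1E.
have [j ->|->] := unliftP ord_max i.
  have -> : lift ord_max j = widen_ord (leqnSn n) j by apply/val_inj/lift_max.
  rewrite mnmwiden_widen mnmE; case: eqP => [/(congr1 val)/=|_]; last by rewrite addn0.
  by move=> e; have := ltn_ord j; rewrite -e ltnn.
by rewrite mnmwiden_ordmax eqxx mul1n.
Qed.

Lemma muni_mwiden (a : {mpoly R[n]}) : muni (mwiden a) = a%:P.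
Proof.
rewrite {1}[a]mpolyE [RHS](congr1 polyC (mpolyE a)).
elim: (msupp a) => [|m s IH]; first by rewrite !big_nil mwiden0 muni0.
rewrite !big_cons mwidenD muniD polyCD IH; congr (_ + _).
rewrite mwidenZ mwidenX muniZ muniX mnmwiden_ordmax expr0.
rewrite scalerA alg_polyC mul_mpolyC.
by congr (_ *: 'X_[_])%:P; apply/mnmP => i; rewrite mnmE mnmwiden_widen.
Qed.

Lemma of_muniK : cancel of_muni (@muni n R).
Proof.
elim/poly_ind => [|P c IH]; first by rewrite of_muni0 muni0.
rewrite of_muniD of_muniM muniD muniM IH /of_muni map_polyX map_polyC !hornerE /=.
rewrite muni_mwiden muniX; congr (_ * _ + _).
rewrite mnm1E eqxx expr1 -[RHS]scale1r; congr (_ *: _).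
rewrite -mpolyX0; congr 'X_[_]; apply/mnmP => i; rewrite mnmE mnm0E mnm1E.
by case: eqP => // /(congr1 val)/= e; have := ltn_ord i; rewrite -e ltnn.
Qed.

Lemma meval_mwiden (x : 'I_n.+1 -> R) (a : {mpoly R[n]}) :
  (mwiden a).@[x] = a.@[fun i => x (widen_ord (leqnSn n) i)].
Proof.
rewrite (mpolyE a); elim: (msupp a) => [|m s IH].
  by rewrite !big_nil mwiden0 !meval0.
rewrite !big_cons mwidenD !mevalD IH; congr (_ + _).
rewrite mwidenZ mwidenX !mevalZ !mevalX big_ord_recr /= mnmwiden_ordmax expr0 mulr1.
by congr (_ * _); apply: eq_bigr => i _; rewrite mnmwiden_widen.
Qed.

Lemma meval_muni (x : 'I_n.+1 -> R) p :
  p.@[x] = (map_poly (meval (fun i => x (widen_ord (leqnSn n) i))) (muni p)).[x ord_max].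
Proof.
rewrite -{1}(muniK p) /of_muni; elim/poly_ind: (muni p) => [|q c IH].
  by rewrite !rmorph0 !horner0 meval0.
rewrite !rmorphD !rmorphM /= !map_polyC !map_polyX !hornerE /= mevalD mevalM IH.
by rewrite mevalXU meval_mwiden.
Qed.
End LastVariable.

(** * Hypersurfaces *)

Lemma mpoly0_const (R : nzRingType) (p : {mpoly R[0]}) : p = (p@_0)%:MP.
Proof.
apply/mpolyP => k; rewrite mcoeffC.
suff -> : k = 0%MM by rewrite eqxx mulr1.
by apply/mnmP => -[].
Qed.

(** Induction on the degree: over a field a nonzero non-unit is nonconstant, so both factors of a
    proper factorization have smaller degree. *)
Lemma mpoly_factorial (F : fieldType) (m : nat) :
  (forall p : {mpoly F[m]}, irreducible_elt p -> prime_elt p) ->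
  factorial_ring {mpoly F[m]}.
Proof.
move=> irrp a; have [k] := ubnP (msize a); elim: k a => // k IH a; rewrite ltnS => le a0.
have [au|au] := boolP (a \is a GRing.unit).
  by exists [::], a; split=> //; rewrite big_nil mulr1.
have [irr|] := pselect (irreducible_elt a).
  exists [:: a], 1; split; rewrite ?unitr1 ?big_seq1 ?mul1r //.
  by move=> p; rewrite inE => /eqP ->; exact: irrp.
move=> /not_and3P[//|//|] /existsNP[b /existsNP[c /not_implyP[e /not_orP[bu cu]]]].
have [b0 c0] : b != 0 /\ c != 0 by apply/andP; rewrite -negb_or -mulf_eq0 -e.
have sz (p : {mpoly F[m]}) : p != 0 -> ~ p \is a GRing.unit -> (1 < msize p)%N.
  move=> p0 pu; rewrite ltnNge; apply/negP => /msize1_polyC ep; apply: pu.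
  rewrite ep; apply: rmorph_unit; rewrite unitfE; apply: contra_neq p0.
  by rewrite {2}ep => ->.
have sb := sz _ b0 bu; have sc := sz _ c0 cu.
have pred_add i j : (1 < j)%N -> (i < (i + j).-1)%N.
  by case: j => [|[|j]] // _; rewrite !addnS /= ltnS leq_addr.
have ea := msizeM b0 c0; rewrite -e in ea.
have [||s [u [ps uu eb]]] := IH b => //.
  by apply: leq_trans le; rewrite ea pred_add.
have [||t [v [pt vu ec]]] := IH c => //.
  by apply: leq_trans le; rewrite ea addnC pred_add.
exists (s ++ t), (u * v); split.
- by move=> p; rewrite mem_cat => /orP[/ps|/pt].
- by rewrite unitrM uu.
by rewrite e eb ec big_cat /= mulrACA.
Qed.

Lemma muni_irreducible (F : fieldType) (m : nat) (p : {mpoly F[m.+1]}) :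
  irreducible_elt p -> irreducible_elt (muni p).
Proof.
have muni_unit (q : {mpoly F[m.+1]}) : (muni q \is a GRing.unit) = (q \is a GRing.unit).
  apply/idP/idP => [/unitrP [r [e _]]|]; last exact: rmorph_unit.
  have e' : of_muni r * q = 1 by rewrite -[q]muniK -of_muniM e of_muni1.
  by apply/unitrP; exists (of_muni r); rewrite [q * _]mulrC e'.
case=> p0 pu pirr; split.
- by apply: contra_neq p0 => e; rewrite -[p]muniK e of_muni0.
- by rewrite muni_unit.
move=> a b e; have := pirr (of_muni a) (of_muni b).
rewrite -!muni_unit !of_muniK; apply.
by rewrite -of_muniM -e muniK.
Qed.

(** Induction on the number of variables: the case of [m] variables makes the coefficient ring
    factorial, and Gauss' lemma applies to the last variable. Without variables every nonzero
    polynomial is a unit. *)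
Lemma mpoly_irreducible_prime (F : fieldType) (m : nat) (p : {mpoly F[m]}) :
  irreducible_elt p -> prime_elt p.
Proof.
elim: m p => [|m IH] p irrp.
  case: irrp => p0 /negP[]; rewrite [p]mpoly0_const.
  by apply: rmorph_unit; rewrite unitfE -(mpolyC_eq0 0) -mpoly0_const.
have [p0 pu pd] := irreducible_poly_prime (mpoly_factorial IH) (muni_irreducible irrp).
case: irrp => q0 qu _; split=> // a b [c e].
have /pd : divides (muni p) (muni a * muni b).
  by exists (muni c); have := congr1 (@muni m F) e; rewrite !muniM.
case=> -[d ed]; [left|right]; exists (of_muni d).
  by rewrite -[a]muniK ed of_muniM muniK.
by rewrite -[b]muniK ed of_muniM muniK.
Qed.

Lemma bezout_map_root (A B : idomainType) (phi : {rmorphism A -> B})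
    (u v f h : {poly A}) (r : A) (t : B) :
  u * f + v * h = r%:P -> (map_poly phi f).[t] = 0 -> (map_poly phi h).[t] = 0 ->
  phi r = 0.
Proof.
move=> e hf hh; have := congr1 (fun q => (map_poly phi q).[t]) e.
rewrite /= rmorphD !rmorphM /= map_polyC hornerC hornerD !hornerM hf hh.
by rewrite !mulr0 addr0.
Qed.

(** * A Nullstellensatz for irreducible hypersurfaces *)

Section ClosedField.

Variable F : closedFieldType.

Definition extend_point (n : nat) (x : 'I_n -> F) (t : F) (i : 'I_n.+1) : F :=
  oapp x t (unlift ord_max i).

Lemma meval_extend_point n (x : 'I_n -> F) (t : F) (p : {mpoly F[n.+1]}) :
  p.@[extend_point x t] = (map_poly (meval x) (muni p)).[t].
Proof.
rewrite meval_muni /extend_point unlift_none /=; congr (_.[t]).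
apply: eq_map_poly => q; apply: meval_eq => i.
have -> : widen_ord (leqnSn n) i = lift ord_max i by apply/val_inj/esym/lift_max.
by rewrite liftK.
Qed.

(** Choose the first coordinates off the zeros of the leading coefficient in the last variable, then
    a last coordinate that is not a root. *)
Lemma mpoly_nonzero_point n (p : {mpoly F[n]}) : p != 0 -> exists x, p.@[x] != 0.
Proof.
elim: n p => [|n IH] p p0.
  by exists (fun=> 0); rewrite [p]mpoly0_const mevalC -(mpolyC_eq0 0) -mpoly0_const.
have P0 : muni p != 0 by apply: contra_neq p0 => e; rewrite -[p]muniK e of_muni0.
have [x hx] : exists x, (lead_coef (muni p)).@[x] != 0.
  by apply: IH; rewrite lead_coef_eq0.
have /closed_nonrootP [t ht] : map_poly (meval x) (muni p) != 0.
  by rewrite -size_poly_eq0 size_map_poly_id0 // size_poly_eq0.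
by exists (extend_point x t); rewrite meval_extend_point.
Qed.

Lemma irreducible_nullstellensatz n (f h : {mpoly F[n]}) : irreducible_elt f ->
  (forall x, f.@[x] = 0 -> h.@[x] = 0) -> divides f h.
Proof.
elim: n f h => [|n IH] f h irrf zfh.
  case: irrf => p0 /negP[]; rewrite [f]mpoly0_const.
  by apply: rmorph_unit; rewrite unitfE -(mpolyC_eq0 0) -mpoly0_const.
suff [q e] : divides (muni f) (muni h).
  by exists (of_muni q); rewrite -[h]muniK e of_muniM muniK.
have irrP := muni_irreducible irrf.
have [sP|sP] := leqP (size (muni f)) 1.
  have eP := size1_polyC sP; rewrite eP in irrP *.
  (* Here [f] does not involve the last variable: above a zero of [f] the polynomial [h] vanishes on
     a whole line, so all its coefficients vanish at that zero. *)
  apply: divides_polyC_coef => i; apply: IH; first exact: irreducible_polyC.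
  move=> x cx; suff /(congr1 (coefp i)) : map_poly (meval x) (muni h) = 0.
    by rewrite /= coef_map coef0.
  apply/eqP; apply/negPn/negP => /closed_nonrootP [t]; apply/negP/negPn/rootP.
  rewrite -meval_extend_point; apply: zfh.
  by rewrite meval_extend_point eP map_polyC hornerC.
have hF := mpoly_factorial (@mpoly_irreducible_prime F n).
have [//|[u [v [r [r0 e]]]]] := irreducible_bezout (muni h) hF irrP sP.
(* Where the leading coefficient is nonzero, the specialization of [f] keeps its positive degree and
   has a root. There [h] vanishes too, hence so does [r], although [x] was chosen off the zeros of
   [r]. *)
have [x] : exists x, (lead_coef (muni f) * r).@[x] != 0.
  apply: mpoly_nonzero_point; rewrite mulf_neq0 // lead_coef_eq0.
  by rewrite -size_poly_gt0 (ltn_trans _ sP).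
rewrite mevalM mulf_eq0 negb_or => /andP[lx /eqP[]].
have /closed_rootP [t /rootP ht] : size (map_poly (meval x) (muni f)) != 1.
  by rewrite size_map_poly_id0 // neq_ltn sP orbT.
apply: (bezout_map_root e ht).
by rewrite -meval_extend_point; apply: zfh; rewrite meval_extend_point ht.
Qed.

End ClosedField.

(** * Zariski closed sets *)

Section ZariskiClosed.

Variables (F : fieldType) (T : Type) (N : nat) (crd : T -> 'I_N -> F).

Lemma zclosed0 : zclosed crd set0.
Proof.
exists [set 1]; apply/seteqP; split=> // x /(_ 1 erefl).
by rewrite meval1 => /eqP; rewrite oner_eq0.
Qed.

Lemma zclosedU A B : zclosed crd A -> zclosed crd B -> zclosed crd (A `|` B).
Proof.
move=> [S ->] [S' ->]; exists [set p | exists a b, [/\ S a, S' b & p = a * b]].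
apply/seteqP; split=> x /=.
  move=> [h|h] p [a [b [ha hb ->]]]; rewrite mevalM.
    by rewrite h // mul0r.
  by rewrite (h b) // mulr0.
move=> h; have [|/existsNP[a /not_implyP[ha an0]]] := pselect (forall p, S p -> p.@[crd x] = 0).
  by left.
right=> b hb; have /eqP := h (a * b) (ex_intro _ a (ex_intro _ b (And3 ha hb erefl))).
by rewrite mevalM mulf_eq0 => /orP[/eqP|/eqP].
Qed.

Lemma zclosed_bigU (I : eqType) (s : seq I) (A : I -> set T) :
  (forall i, zclosed crd (A i)) -> zclosed crd [set x | exists2 i, i \in s & A i x].
Proof.
move=> hA; elim: s => [|i s IH].
  suff -> : [set x | exists2 i, i \in [::] & A i x] = set0 by exact: zclosed0.
  by apply/seteqP; split=> // x [].
suff -> : [set x | exists2 j, j \in i :: s & A j x] =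
    A i `|` [set x | exists2 j, j \in s & A j x] by exact: zclosedU.
apply/seteqP; split=> x /=.
  by case=> j; rewrite inE => /orP[/eqP -> ?|? ?]; [left|right; exists j].
by case=> [?|[j js ?]]; [exists i; rewrite ?mem_head|exists j; rewrite // inE js orbT].
Qed.

End ZariskiClosed.

(** * Regular functions on a linear group *)

Section RegularFunctions.

Variables (F : fieldType) (n : nat) (G : set 'M[F]_n).
Hypothesis G_unit : forall g, G g -> g \in unitmx.

Definition det_poly : {mpoly F[n * n]} := \det (\matrix_(i, j) 'X_(mxvec_index i j)).

Lemma meval_det_poly (g : 'M[F]_n) : det_poly.@[mx_crd g] = \det g.
Proof.
rewrite /det_poly -det_map_mx; congr (\det _); apply/matrixP => i j.
by rewrite !mxE /= mevalXU /mx_crd mxvecE.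
Qed.

Let det0 g : G g -> \det g != 0.
Proof. by move=> /G_unit; rewrite unitmxE unitfE. Qed.

Lemma regular_cst c : regular_on G (fun=> c).
Proof. by exists c%:MP, 0%N => g _; rewrite mevalC expr0 divr1. Qed.

Lemma regularD f1 f2 : regular_on G f1 -> regular_on G f2 ->
  regular_on G (fun g => f1 g + f2 g).
Proof.
move=> [p1 [k1 h1]] [p2 [k2 h2]].
exists (p1 * det_poly ^+ k2 + p2 * det_poly ^+ k1), (k1 + k2)%N => g hg.
rewrite h1 // h2 // mevalD !mevalM !rmorphXn /= !meval_det_poly.
have d1 := expf_neq0 k1 (det0 hg); have d2 := expf_neq0 k2 (det0 hg).
by rewrite addf_div // exprD.
Qed.

Lemma regularM f1 f2 : regular_on G f1 -> regular_on G f2 ->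
  regular_on G (fun g => f1 g * f2 g).
Proof.
move=> [p1 [k1 h1]] [p2 [k2 h2]].
exists (p1 * p2), (k1 + k2)%N => g hg.
by rewrite h1 // h2 // mevalM mulf_div exprD.
Qed.

Lemma regular_meval m (v : 'M[F]_n -> 'I_m -> F) (p : {mpoly F[m]}) :
  (forall i, regular_on G (fun g => v g i)) ->
  regular_on G (fun g => p.@[v g]).
Proof.
move=> hv; under [X in regular_on _ X]funext do rewrite mevalE.
elim: (msupp p) => [|k s IH].
  by under [X in regular_on _ X]funext do rewrite big_nil; exact: regular_cst.
under [X in regular_on _ X]funext do rewrite big_cons.
apply: regularD IH; apply: regularM; first exact: regular_cst.
elim: (index_enum _) => [|i t IH].
  by under [X in regular_on _ X]funext do rewrite big_nil; exact: regular_cst.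
under [X in regular_on _ X]funext do rewrite big_cons.
apply: regularM IH; elim: (k i) => [|l IH].
  by under [X in regular_on _ X]funext do rewrite expr0; exact: regular_cst.
by under [X in regular_on _ X]funext do rewrite exprS; exact: regularM.
Qed.

(* The determinant is invertible on [G], so that only the numerators matter. *)
Lemma regular_zeros_closed (I : Type) (D : set I) (f : I -> 'M[F]_n -> F) :
  (forall i, regular_on G (f i)) ->
  exists2 A, mx_closed A &
    forall g, G g -> (A g <-> forall i, D i -> f i g = 0).
Proof.
move=> /choice[p /choice[k hf]].
exists [set g | forall i, D i -> (p i).@[mx_crd g] = 0].
  exists [set q | exists2 i, D i & q = p i]; apply/seteqP; split=> g /=.
    by move=> h _ [i Di ->]; exact: h.
  by move=> h i Di; apply: h; exists i.
move=> g hg; have E i : (f i g = 0) <-> ((p i).@[mx_crd g] = 0).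
  rewrite hf //; split=> [/eqP|->]; last by rewrite mul0r.
  by rewrite mulf_eq0 invr_eq0 (negbTE (expf_neq0 _ (det0 hg))) orbF => /eqP.
by split=> h i Di; apply/E/h.
Qed.

End RegularFunctions.

(** * Linear changes of coordinates *)

Section LinearSubstitution.

Variables (F : fieldType) (m : nat).
Implicit Types (A B : 'M[F]_m) (p q : {mpoly F[m]}) (x : 'cV[F]_m) (S Z : set 'cV[F]_m).

(** [poly_act rho g] is the case where [A] is [rho (invmx g)]. *)
Definition lin_subst A p : {mpoly F[m]} :=
  p \mPo [tuple \sum_(j < m) A i j *: 'X_j | i < m].

Lemma meval_lin_subst A p x : (lin_subst A p).@[vec_crd x] = p.@[vec_crd (A *m x)].
Proof.
rewrite comp_mpoly_meval; apply: meval_eq => i.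
rewrite tnth_mktuple (raddf_sum (meval _)) /vec_crd mxE; apply: eq_bigr => j _.
by rewrite /= mevalZ mevalXU.
Qed.

Definition preimage_mx A Z : set 'cV[F]_m := [set x | Z (A *m x)].

Lemma preimage_mxK A B Z : A *m B = 1%:M -> preimage_mx B (preimage_mx A Z) = Z.
Proof.
by move=> AB; apply/seteqP; split=> x; rewrite /preimage_mx /= mulmxA AB mul1mx.
Qed.

Lemma preimage_closed A Z : vec_closed Z -> vec_closed (preimage_mx A Z).
Proof.
move=> [S ->]; exists [set q | exists2 p, S p & q = lin_subst A p].
apply/seteqP; split=> x /=.
  by move=> h _ [p Sp ->]; rewrite meval_lin_subst; exact: h.
by move=> h p Sp; rewrite -meval_lin_subst; apply: h; exists p.
Qed.

Lemma preimage_subset A Y Z : Y `<=` Z -> preimage_mx A Y `<=` preimage_mx A Z.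
Proof. by move=> YZ x; exact: YZ. Qed.

Section Invertible.

Variables (A B : 'M[F]_m).
Hypotheses (AB : A *m B = 1%:M) (BA : B *m A = 1%:M).

Lemma preimage_subset_swap Y Z : preimage_mx A Y `<=` Z -> Y `<=` preimage_mx B Z.
Proof. by move=> /(@preimage_subset B); rewrite preimage_mxK. Qed.

Lemma preimage_irreducible Z : vec_irreducible Z -> vec_irreducible (preimage_mx A Z).
Proof.
move=> [[x Zx] irr]; split; first by exists (B *m x); rewrite /preimage_mx /= mulmxA AB mul1mx.
move=> C D cC cD /preimage_subset_swap.
move=> /(irr (preimage_mx B C) (preimage_mx B D)).
case=> [||/(@preimage_subset A)|/(@preimage_subset A)]; try exact: preimage_closed.
  by rewrite preimage_mxK //; left.
by rewrite preimage_mxK //; right.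
Qed.

End Invertible.

(** A linear automorphism preserving [S] permutes its components: a larger irreducible closed set is
    pulled back by the inverse [B] and compared with [Z]. *)
Lemma preimage_component A B S Z : A *m B = 1%:M -> B *m A = 1%:M ->
  preimage_mx A S = S -> irreducible_component S Z ->
  irreducible_component S (preimage_mx A Z).
Proof.
move=> AB BA AS [cZ iZ ZS mx]; split.
- exact: preimage_closed.
- exact: (preimage_irreducible AB BA).
- by rewrite -AS; exact: preimage_subset.
move=> Y cY iY YS /(preimage_subset_swap AB) ZY.
rewrite -(mx (preimage_mx B Y)) ?preimage_mxK //.
- exact: preimage_closed.
- exact: (preimage_irreducible BA AB).
- by rewrite -[S](preimage_mxK _ AB) AS; exact: preimage_subset.
Qed.

Lemma preimage_codim_one A B Z : A *m B = 1%:M -> B *m A = 1%:M ->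
  codim_one Z -> codim_one (preimage_mx A Z).
Proof.
move=> AB BA [ZT mx]; split.
  move=> e; apply: ZT; rewrite -[Z](preimage_mxK _ AB) e.
  by apply/seteqP; split.
move=> Y cY iY /(preimage_subset_swap AB) ZY.
have [||//|e|e] := mx (preimage_mx B Y).
- exact: preimage_closed.
- exact: (preimage_irreducible BA AB).
- by left; rewrite -e preimage_mxK.
- by right; rewrite -[Y](preimage_mxK _ BA) e; apply/seteqP; split.
Qed.

End LinearSubstitution.

(** * Relative invariants *)

Lemma mpoly_unit_const (F : fieldType) (m : nat) (p : {mpoly F[m]}) :
  p \is a GRing.unit -> exists c, p = c%:MP.
Proof. by case/andP => /eqP e _; exists p@_0. Qed.

Lemma mpoly_ext (F : closedFieldType) (m : nat) (p q : {mpoly F[m]}) :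
  (forall x : 'cV[F]_m, p.@[vec_crd x] = q.@[vec_crd x]) -> p = q.
Proof.
move=> h; apply/eqP; rewrite -subr_eq0; apply/negPn/negP => /mpoly_nonzero_point [x].
have -> : (p - q).@[x] = (p - q).@[vec_crd (\col_i x i)].
  by apply: meval_eq => i; rewrite /vec_crd mxE.
by rewrite mevalB h subrr eqxx.
Qed.

Section Representation.

Variables (F : closedFieldType) (n m : nat).
Variables (G : set 'M[F]_n) (rho : 'M[F]_n -> 'M[F]_m).
Hypotheses (hG : algebraic_group G) (hrho : rational_rep G rho).

Lemma group_unit g : G g -> g \in unitmx.
Proof. by case: hG => -[Z _ ->] _ _ _ []. Qed.

Lemma group_inv g : G g -> G (invmx g).
Proof. by case: hG => _ _ _; exact. Qed.

Lemma rho_invr g : G g -> rho g *m rho (invmx g) = 1%:M.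
Proof.
case: hrho => r1 rM _ hg; rewrite -rM ?mulmxV ?group_unit //.
exact: group_inv.
Qed.

Lemma rho_invl g : G g -> rho (invmx g) *m rho g = 1%:M.
Proof.
case: hrho => r1 rM _ hg; rewrite -rM ?mulVmx ?group_unit //.
exact: group_inv.
Qed.

Lemma meval_poly_act g p x :
  (poly_act rho g p).@[vec_crd x] = p.@[vec_crd (rho (invmx g) *m x)].
Proof. exact: meval_lin_subst. Qed.

Lemma poly_actK g p : G g -> poly_act rho (invmx g) (poly_act rho g p) = p.
Proof.
move=> hg; apply: mpoly_ext => x.
by rewrite !meval_poly_act invmxK mulmxA rho_invl // mul1mx.
Qed.

Lemma poly_actVK g p : G g -> poly_act rho g (poly_act rho (invmx g) p) = p.
Proof. by move=> hg; have := poly_actK p (group_inv hg); rewrite invmxK. Qed.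

Lemma poly_actM g p q : poly_act rho g (p * q) = poly_act rho g p * poly_act rho g q.
Proof. exact: rmorphM. Qed.

Lemma open_orbit_stable g : G g ->
  preimage_mx (rho g) (~` open_orbit G rho) = ~` open_orbit G rho.
Proof.
move=> hg; have [_ rM _] := hrho; have [_ _ GM GV] := hG.
suff E x : orbit_of G rho (rho g *m x) = orbit_of G rho x.
  by apply/seteqP; split=> x; rewrite /preimage_mx /open_orbit /= E.
apply/seteqP; split=> y [h hh <-].
  by exists (h *m g); rewrite ?rM ?mulmxA //; exact: GM.
exists (h *m invmx g); first by apply: GM => //; exact: GV.
by rewrite rM ?mulmxA -?[_ *m rho (invmx g) *m _]mulmxA ?rho_invl ?mulmx1 //; exact: GV.
Qed.

Definition relative_invariant (P : {mpoly F[m]}) : Prop :=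
  forall g, G g -> exists c, poly_act rho g P = c *: P.

Lemma relative_invariant1 : relative_invariant 1.
Proof. by move=> g _; exists 1; rewrite scale1r; exact: rmorph1. Qed.

Lemma relative_invariantM P Q :
  relative_invariant P -> relative_invariant Q -> relative_invariant (P * Q).
Proof.
move=> hP hQ g hg; have [c hc] := hP g hg; have [d hd] := hQ g hg.
by exists (c * d); rewrite poly_actM hc hd -scalerAl -scalerAr scalerA.
Qed.

Lemma relative_invariant_prod (r : nat) (Delta : 'I_r -> {mpoly F[m]}) (e : 'I_r -> nat) :
  (forall i, relative_invariant (Delta i)) ->
  relative_invariant (\prod_(i < r) Delta i ^+ e i).
Proof.
move=> h; apply: big_ind => [||i _]; [exact: relative_invariant1|exact: relative_invariantM|].
elim: (e i) => [|k IH]; first exact: relative_invariant1.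
by rewrite exprS; exact: relative_invariantM.
Qed.

(** * Relative invariance of the polynomials defining the components *)

Section Fundamental.

Variables (r : nat) (Delta : 'I_r -> {mpoly F[m]}).
Hypotheses (hconn : zconnected G)
  (hDelta : fundamental_relative_invariants G rho Delta).

Lemma zero_locus_component i :
  irreducible_component (~` open_orbit G rho) (zero_locus (Delta i)) /\
  codim_one (zero_locus (Delta i)).
Proof. by case: hDelta => _ _ /(_ (zero_locus (Delta i))) [_]; apply; exists i. Qed.

Lemma component_permuted g i : G g ->
  exists j, preimage_mx (rho g) (zero_locus (Delta i)) = zero_locus (Delta j).
Proof.
move=> hg; case: hDelta => _ _ /(_ (preimage_mx (rho g) (zero_locus (Delta i)))) [+ _].
have [ci di] := zero_locus_component i.
have gV := rho_invr hg; have Vg := rho_invl hg.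
apply; split; last exact: (preimage_codim_one gV Vg).
exact: (preimage_component gV Vg (open_orbit_stable hg)).
Qed.

Lemma zero_locus_inj i j : zero_locus (Delta i) `<=` zero_locus (Delta j) -> i = j.
Proof.
have [_ inj _] := hDelta.
have [[_ _ _ mx] _] := zero_locus_component i; have [[cj ij sj _] _] := zero_locus_component j.
by move=> /(mx _ cj ij sj)/inj.
Qed.

(* The sets of those [g] which carry one given component to another one are
   closed and partition the connected group [G]. *)
Lemma component_fixed g i : G g ->
  preimage_mx (rho g) (zero_locus (Delta i)) = zero_locus (Delta i).
Proof.
have [_ _ reg] := hrho; have [_ G1 _ _] := hG; have [r1 _ _] := hrho.
pose f (x : 'cV[F]_m) h := (Delta i).@[vec_crd (rho h *m x)].
have freg x : regular_on G (f x).
  apply: regular_meval => [|k]; first exact: group_unit.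
  rewrite /vec_crd; under [X in regular_on _ X]funext do rewrite mxE.
  elim: (index_enum _) => [|j s IH].
    by under [X in regular_on _ X]funext do rewrite big_nil; exact: regular_cst.
  under [X in regular_on _ X]funext do rewrite big_cons.
  apply: (regularD group_unit) IH; apply: regularM; first exact: reg.
  exact: regular_cst.
(* The equations [f x h = 0] only express an inclusion of zero loci. It is an equality because the
   preimage is again the zero locus of some [Delta k], and components are maximal. *)
have /choice [C hC] j : exists C, mx_closed C /\ forall h, G h ->
    (C h <-> preimage_mx (rho h) (zero_locus (Delta i)) = zero_locus (Delta j)).
  have [C cC hC] := regular_zeros_closed group_unit (zero_locus (Delta j)) freg.
  exists C; split=> // h hh; rewrite hC //; split=> [z|e x]; last by rewrite -e.
  have [k e] := component_permuted i hh; rewrite e; congr (zero_locus (Delta _)).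
  by apply/esym/zero_locus_inj => x /z fx; rewrite -e; exact: fx.
(* A finite union of closed sets. By connectedness [G] lies in [C i] or in [B], and the identity
   matrix excludes [B]. *)
pose B := [set h | exists2 j, j \in [seq j <- enum 'I_r | j != i] & C j h].
have [|||GC|GB] := hconn (A := C i) (B := B) (proj1 (hC i)).
- by apply: zclosed_bigU => j; case: (hC j).
- move=> h hh; have [j e] := component_permuted i hh.
  have [<-|ji] := eqVneq j i; first by left; apply/(proj2 (hC j)).
  right; exists j; first by rewrite mem_filter ji mem_enum.
  by apply/(proj2 (hC j)).
- apply/seteqP; split=> // h [[hh /(proj2 (hC i) _ hh) e] [j]].
  rewrite mem_filter => /andP[/eqP ji _] /(proj2 (hC j) _ hh) e'; apply: ji.
  by apply: zero_locus_inj; rewrite -e' e.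
- by move=> hg; apply/(proj2 (hC i) _ hg)/GC.
have [j] := GB _ G1; rewrite mem_filter => /andP[/eqP ji _] /(proj2 (hC j) _ G1) e.
by exfalso; apply: ji; apply: zero_locus_inj; rewrite -e r1 => x; rewrite /preimage_mx /= mul1mx.
Qed.

(** Since every [g] fixes the zero locus, the Nullstellensatz makes [Delta i] divide its transform.
    The quotients obtained for [g] and its inverse show that the former is a unit, that is a
    scalar. *)
Lemma fundamental_relative_invariant i : relative_invariant (Delta i).
Proof.
have [irr _ _] := hDelta; have irri := irr i.
have dvd g : G g -> divides (Delta i) (poly_act rho g (Delta i)).
  move=> /group_inv hg; apply: irreducible_nullstellensatz => // v.
  have E (p : {mpoly F[m]}) : p.@[v] = p.@[vec_crd (\col_i v i)].
    by apply: meval_eq => k; rewrite /vec_crd mxE.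
  rewrite !E meval_poly_act => h.
  suff : preimage_mx (rho (invmx g)) (zero_locus (Delta i)) (\col_i v i) by [].
  by rewrite component_fixed.
move=> g hg; have [c ec] := dvd g hg; have [d ed] := dvd _ (group_inv hg).
have [i0 _ _] := irri.
have : c * poly_act rho g d = 1.
  by apply: (mulfI i0); rewrite mulrA -ec -poly_actM -ed poly_actVK // mulr1.
move=> cd; have /mpoly_unit_const [a ea] : c \is a GRing.unit.
  by apply/unitrP; exists (poly_act rho g d); rewrite [_ d * c]mulrC cd.
by exists a; rewrite ec ea mulrC mul_mpolyC.
Qed.

End Fundamental.

End Representation.

(** * Multiplicity free representations *)

Section Schur.

Variables (F : closedFieldType) (n m : nat).
Variables (G : set 'M[F]_n) (rho : 'M[F]_n -> 'M[F]_m).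
Hypotheses (hG : algebraic_group G) (hrho : rational_rep G rho).

Implicit Types (U W : set {mpoly F[m]}) (T : {mpoly F[m]} -> {mpoly F[m]}).

Definition linear_on U T : Prop :=
  forall (a : F) p q, U p -> U q -> T (a *: p + q) = a *: T p + T q.

(** When [chi] is a character, this is equivariance of [T] on the tensor product of [U] with
    [chi]. *)
Definition twisted_equivariant_on U (chi : 'M[F]_n -> F) T : Prop :=
  forall g p, G g -> U p -> poly_act rho g (T p) = chi g *: T (poly_act rho g p).

Lemma linear_on0 U T : U 0 -> linear_on U T -> T 0 = 0.
Proof.
move=> U0 /(_ 1 0 0 U0 U0); rewrite !scale1r addr0 => /eqP.
by rewrite -subr_eq0 opprD addNKr oppr_eq0 => /eqP.
Qed.

Section Image.

Variables (U : set {mpoly F[m]}) (chi : 'M[F]_n -> F) (T : {mpoly F[m]} -> {mpoly F[m]}).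
Hypotheses (linT : linear_on U T) (eqT : twisted_equivariant_on U chi T).

Lemma subrep_image : subrep G rho U -> subrep G rho (T @` U).
Proof.
move=> [U0 UL UG]; split.
- by exists 0 => //; exact: linear_on0 linT.
- move=> a _ _ [p Up <-] [q Uq <-]; exists (a *: p + q); [exact: UL|exact: linT].
move=> g _ hg [p Up <-]; rewrite eqT //.
have Ugp := UG _ _ hg Up.
exists (chi g *: poly_act rho g p + 0); first exact: UL.
by rewrite linT // (linear_on0 U0 linT) addr0.
Qed.

Hypothesis chi0 : forall g, G g -> chi g != 0.

Lemma subrep_preimage W : subrep G rho U -> subrep G rho W ->
  subrep G rho [set p | U p /\ W (T p)].
Proof.
move=> [U0 UL UG] [W0 WL WG]; split.
- by split; rewrite ?(linear_on0 U0 linT).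
- by move=> a p q [Up Wp] [Uq Wq]; split; [exact: UL|rewrite linT //; exact: WL].
move=> g p hg [Up Wp]; split; first exact: UG.
have -> : T (poly_act rho g p) = (chi g)^-1 *: poly_act rho g (T p) + 0.
  by rewrite eqT // scalerA mulVf ?chi0 // scale1r addr0.
by apply: WL => //; exact: WG.
Qed.

Lemma subrep0 : subrep G rho [set 0].
Proof.
split=> //= [a p q -> ->|g p _ ->]; first by rewrite scaler0 addr0.
exact: rmorph0.
Qed.

Hypothesis irrU : irreducible_subrep G rho U.

(** The kernel is the preimage of the zero subrepresentation, hence a subrepresentation of [U], and
    it is proper. *)
Lemma schur_injective : (exists2 p, U p & T p <> 0) ->
  forall p q, U p -> U q -> T p = T q -> p = q.
Proof.
have [sU _ minU] := irrU; have [U0 UL UG] := sU => -[p0 Up0 Tp0].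
have ker : [set p | U p /\ [set 0] (T p)] = [set 0].
  have [|//|kU] := minU _ (subrep_preimage sU subrep0); first by move=> p [].
  by move: Up0; rewrite -kU => -[_ /Tp0].
move=> p q Up Uq e; apply/eqP; rewrite -subr_eq0; apply/eqP.
have : [set 0] ((-1) *: q + p); last by rewrite scaleN1r addrC.
rewrite -ker; split; first exact: UL.
by rewrite /= linT // e scaleN1r addNr.
Qed.

(** A subrepresentation of the image pulls back to a subrepresentation of [U], which is zero or all
    of [U]. *)
Lemma schur_irreducible : (exists2 p, U p & T p <> 0) ->
  irreducible_subrep G rho (T @` U).
Proof.
have [sU _ minU] := irrU; move=> ex; have [p0 Up0 Tp0] := ex.
have [U0 UL UG] := sU.
split; first exact: subrep_image.
  by move=> e; apply: Tp0; have : (T @` U) (T p0) by [exists p0]; rewrite e.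
move=> W sW WU; have [|e|e] := minU _ (subrep_preimage sU sW).
- by move=> p [].
- left; apply/seteqP; split=> [w Ww|_ ->]; last by case: sW.
  have [p Up ep] := WU _ Ww; have : [set p | U p /\ W (T p)] p by split; rewrite ?ep.
  by rewrite e -ep => ->; exact: linear_on0 linT.
right; apply/seteqP; split=> // _ [p Up <-].
by move: Up; rewrite -e => -[].
Qed.

End Image.

(** The isomorphism sends [T1 p] to [T2 p]; it is untwisted because both maps carry the same
    [chi]. *)
Lemma schur_iso U chi T1 T2 : irreducible_subrep G rho U ->
  (forall g, G g -> chi g != 0) ->
  linear_on U T1 -> linear_on U T2 ->
  twisted_equivariant_on U chi T1 -> twisted_equivariant_on U chi T2 ->
  (exists2 p, U p & T1 p <> 0) -> (exists2 p, U p & T2 p <> 0) ->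
  subrep_iso G rho (T1 @` U) (T2 @` U).
Proof.
move=> irrU chi0 l1 l2 e1 e2 ex1 ex2; have [[U0 UL UG] _ _] := irrU.
have inj1 := schur_injective l1 e1 chi0 irrU ex1.
have inj2 := schur_injective l2 e2 chi0 irrU ex2.
(* Well defined by injectivity of [T1], with the default value 0 off the image. *)
have [f hf] : exists f, forall p, U p -> f (T1 p) = T2 p.
  have /choice [f hf] q : exists y, forall p, U p -> T1 p = q -> y = T2 p.
    have [[p [Up ep]]|no] := pselect (exists p, U p /\ T1 p = q).
      by exists (T2 p) => p' Up' ep'; congr T2; apply: inj1; rewrite // ep.
    by exists 0 => p Up ep; case: no; exists p.
  by exists f => p Up; exact: hf.
exists f; split.
- split.
  + by move=> _ [p Up <-]; exists p; rewrite ?hf.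
  + move=> _ _ /set_mem[p Up <-] /set_mem[q Uq <-]; rewrite !hf // => e.
    by congr T1; exact: inj2.
  + by move=> _ [p Up <-]; exists (T1 p); [exists p|rewrite hf].
- move=> a _ _ [p Up <-] [q Uq <-].
  by rewrite -l1 // !hf // ?l2 //; exact: UL.
move=> g _ hg [p Up <-].
rewrite e1 // hf // e2 //; have Ugp := UG _ _ hg Up.
rewrite -[in LHS](addr0 (chi g *: _)) -(linear_on0 U0 l1) -l1 // hf; last exact: UL.
by rewrite l2 // (linear_on0 U0 l2) addr0.
Qed.

(** * Equivariant projections of a direct sum *)

Section DirectSum.

Variables (I : choiceType) (U : I -> set {mpoly F[m]}).
Hypotheses (dU : direct_sum_decomposition U) (sU : forall i, subrep G rho (U i)).

Let closed_sum i (s : seq I) (P : pred I) (u : I -> {mpoly F[m]}) :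
  (forall k, P k -> U i (u k)) -> U i (\sum_(k <- s | P k) u k).
Proof.
have [U0 UL _] := sU i; move=> h; apply: big_ind => // p q Up Uq.
by rewrite -[p]scale1r; exact: UL.
Qed.

(** The list in a decomposition may repeat indices. Merging equal indices gives components that can
    be summed over any larger duplicate-free list, so that several polynomials can share one
    list. *)
Lemma direct_sum_support p : exists (s : seq I) (u : I -> {mpoly F[m]}),
  [/\ forall i, U i (u i), forall i, i \notin s -> u i = 0
    & forall t, uniq t -> {subset s <= t} -> p = \sum_(i <- t) u i].
Proof.
have [/(_ p) [s [u [hu ->]]] _] := dU.
exists s, (fun k => \sum_(i <- s | i == k) u i); split.
- by move=> k; apply: closed_sum => i /eqP ->.
- by move=> k ks; apply: big1_seq => i /andP[/eqP -> si]; rewrite si in ks.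
move=> t ut sub; elim: s sub => [|i s IH] sub.
  by rewrite big_nil big1 // => k _; rewrite big_nil.
rewrite big_cons IH; last by move=> k ks; apply: sub; rewrite inE ks orbT.
have it : i \in t by apply: sub; rewrite mem_head.
rewrite (bigD1_seq i) //= [in RHS](bigD1_seq i) //= big_cons eqxx addrA.
congr (_ + _); apply: eq_bigr => k ki.
by rewrite big_cons eq_sym (negbTE ki).
Qed.

(** The components are chosen separately for each polynomial; linearity and equivariance follow from
    uniqueness of the decomposition. *)
Lemma direct_sum_projections : exists pr : I -> {mpoly F[m]} -> {mpoly F[m]},
  [/\ forall j p, U j (pr j p),
      forall j (a : F) p q, pr j (a *: p + q) = a *: pr j p + pr j q,
      forall j g p, G g -> poly_act rho g (pr j p) = pr j (poly_act rho g p)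
    & forall p, exists s, uniq s /\ p = \sum_(j <- s) pr j p].
Proof.
have [s /choice [pr hpr]] := choice direct_sum_support.
have [_ dirU] := dU.
have pr_in p j : U j (pr p j) by case: (hpr p).
have pr_out p j : j \notin s p -> pr p j = 0 by case: (hpr p) => _ + _; exact.
have pr_sum p t : uniq t -> {subset s p <= t} -> p = \sum_(i <- t) pr p i.
  by case: (hpr p) => _ _; exact.
(* Uniqueness for families supported in a list, applied below to lists containing the supports of
   all the polynomials involved. *)
have zero t (u : I -> {mpoly F[m]}) j : (forall i, U i (u i)) ->
    (forall i, i \notin t -> u i = 0) -> \sum_(i <- undup t) u i = 0 -> u j = 0.
  move=> hu h0 e; have [jt|/h0//] := boolP (j \in t).
  by apply: (dirU _ _ (undup_uniq t) hu e); rewrite mem_undup.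
have subU k p q : U k p -> U k q -> U k (p - q).
  by have [_ UL _] := sU k; move=> hp hq; rewrite addrC -scaleN1r; exact: UL.
have sub (t1 t2 : seq I) : {subset t1 <= undup (t1 ++ t2)}.
  by move=> k kt; rewrite mem_undup mem_cat kt.
have sub' (t1 t2 t3 : seq I) : {subset t2 <= t3} -> {subset t2 <= undup (t1 ++ t3)}.
  by move=> h k /h kt; rewrite mem_undup mem_cat kt orbT.
exists (fun j p => pr p j); split=> //.
- move=> j a p q; apply/eqP; rewrite -subr_eq0; apply/eqP.
  pose t := s (a *: p + q) ++ (s p ++ s q).
  apply: (zero t (fun j => pr (a *: p + q) j - (a *: pr p j + pr q j))).
  + by move=> k; have [_ UL _] := sU k; apply: subU => //; exact: UL.
  + move=> k; rewrite !mem_cat !negb_or => /and3P[k1 k2 k3].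
    by rewrite !pr_out // scaler0 addr0 subr0.
  rewrite sumrB big_split -scaler_sumr /=.
  rewrite -!pr_sum ?undup_uniq ?subrr //.
  + by apply: sub' => k kq; rewrite mem_cat kq orbT.
  + by apply: sub' => k kp; rewrite mem_cat kp.
  + exact: sub.
- move=> j g p hg; apply/eqP; rewrite -subr_eq0; apply/eqP.
  apply: (zero (s p ++ s (poly_act rho g p))
    (fun j => poly_act rho g (pr p j) - pr (poly_act rho g p) j)).
  + by move=> k; have [_ _ UG] := sU k; apply: subU => //; exact: UG.
  + move=> k; rewrite mem_cat negb_or => /andP[k1 k2].
    by rewrite !pr_out // subr0; exact: rmorph0.
  rewrite sumrB -(raddf_sum (comp_mpoly _)) /=.
  rewrite -(pr_sum p (undup _)) ?undup_uniq //.
  rewrite -(pr_sum (poly_act rho g p)) ?undup_uniq //.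
    exact: subrr.
  by apply: sub' => k.
by move=> p; exists (undup (s p)); rewrite undup_uniq; split=> //; apply: pr_sum;
  rewrite ?undup_uniq // => k; rewrite mem_undup.
Qed.

End DirectSum.

(** A projection that is nonzero on [W] maps it isomorphically onto its summand. Two such summands
    would be isomorphic, so only one projection survives, and it is the identity on [W]. *)
Lemma irreducible_subrep_summand (I : choiceType) (U : I -> set {mpoly F[m]}) W :
  direct_sum_decomposition U -> (forall i, irreducible_subrep G rho (U i)) ->
  (forall i j, subrep_iso G rho (U i) (U j) -> i = j) ->
  irreducible_subrep G rho W -> exists i, W = U i.
Proof.
move=> dU irrU isoU irrW; have sU i : subrep G rho (U i) by case: (irrU i).
have [pr [prU prL prG prS]] := direct_sum_projections dU sU.
have [sW W0 minW] := irrW.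
have lin j : linear_on W (pr j) by move=> a p q _ _; exact: prL.
have eqv j : twisted_equivariant_on W (fun=> 1) (pr j).
  by move=> g p hg _; rewrite scale1r prG.
have image j : (exists2 p, W p & pr j p <> 0) -> pr j @` W = U j.
  move=> [p Wp pn]; have [_ _ minU] := irrU j.
  have [||//] := minU (pr j @` W) (subrep_image (lin j) (eqv j) sW).
  - by move=> _ [q _ <-].
  - by move=> e; case: pn; have : (pr j @` W) (pr j p) by [exists p]; rewrite e.
have [p Wp pn] : exists2 p, W p & p <> 0.
  apply: contrapT => h; apply: W0; apply/seteqP; split=> [p Wp|_ ->]; last by case: sW.
  by apply: contrapT => pn; apply: h; exists p.
have [j pj] : exists j, pr j p <> 0.
  apply: contrapT => h; apply: pn; have [s [_ ->]] := prS p.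
  by rewrite big1 // => j _; apply: contrapT => pj; apply: h; exists j.
have ij : exists2 p, W p & pr j p <> 0 by exists p.
have other k q : W q -> k != j -> pr k q = 0.
  move=> Wq /eqP kj; apply: contrapT => pk; apply: kj; apply: isoU.
  have ik : exists2 p, W p & pr k p <> 0 by exists q.
  rewrite -(image _ ik) -(image _ ij).
  by apply: (schur_iso irrW (chi := fun=> 1)) => // g _; exact: oner_neq0.
exists j; rewrite -(image _ ij).
have self q : W q -> q = pr j q.
  move=> Wq; have [s [us e]] := prS q.
  (* If the list omits [j], all the terms of the sum vanish and [q] is 0. *)
  have [js|js] := boolP (j \in s).
    by rewrite {1}e (bigD1_seq j) //= big1 ?addr0 // => k kj; exact: other.
  have q0 : q = 0.
    rewrite e big1_seq // => k /andP[_ ks]; apply: other => //.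
    by apply: contraNneq js => <-.
  have [W00 _ _] := sW.
  by rewrite q0 (linear_on0 W00 (lin j)).
apply/seteqP; split=> [q Wq|_ [q Wq <-]]; first by exists q; rewrite // -self.
by rewrite -self.
Qed.

(* Both images are summands of the same isomorphism type, hence equal. *)
Lemma multiplicity_free_image U chi T1 T2 :
  multiplicity_free G rho -> irreducible_subrep G rho U ->
  (forall g, G g -> chi g != 0) ->
  linear_on U T1 -> linear_on U T2 ->
  twisted_equivariant_on U chi T1 -> twisted_equivariant_on U chi T2 ->
  (exists2 p, U p & T1 p <> 0) -> T2 @` U `<=` T1 @` U.
Proof.
move=> [I [V [dV irrV isoV]]] irrU chi0 l1 l2 e1 e2 ex1.
have irr1 := schur_irreducible l1 e1 chi0 irrU ex1.
have [ex2|no] := pselect (exists2 p, U p & T2 p <> 0).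
  have irr2 := schur_irreducible l2 e2 chi0 irrU ex2.
  have iso := schur_iso irrU chi0 l1 l2 e1 e2 ex1 ex2.
  have [i ei] := irreducible_subrep_summand dV irrV isoV irr1.
  have [j ej] := irreducible_subrep_summand dV irrV isoV irr2.
  by rewrite ei ej in iso *; rewrite (isoV _ _ iso).
move=> _ [p Up <-]; have -> : T2 p = 0 by apply: contrapT => h; apply: no; exists p.
by have [[]] := irr1.
Qed.

End Schur.

(** * Rational functions *)

Lemma fraction_repr (R : idomainType) (f : {fraction R}) :
  f = FracField.tofrac \n_(repr f) / FracField.tofrac \d_(repr f).
Proof.
have d0 : FracField.tofrac \d_(repr f) != 0 by rewrite tofrac_eq0 denom_ratioP.
apply: (mulIf d0); rewrite divfK // -{1}[f]reprK; unlock FracField.tofrac.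
rewrite -[LHS]FracField.pi_mul; apply/eqmodP => /=.
by rewrite /FracField.equivf /FracField.mulf !numden_Ratio ?mulf_neq0 ?oner_neq0 ?denom_ratioP //= !mulr1 mulrC.
Qed.

Section Fraction.

Variables (F : fieldType) (m : nat).
Implicit Types (f h : ratfun F m) (p q r s : {mpoly F[m]}).

Lemma rat_of_poly_eq0 p : (rat_of_poly p == 0) = (p == 0).
Proof. exact: tofrac_eq0. Qed.

Lemma rat_of_poly_inj : injective (@rat_of_poly F m).
Proof. by move=> p q /eqP; rewrite tofrac_eq => /eqP. Qed.

Lemma rat_of_polyD p q : rat_of_poly (p + q) = rat_of_poly p + rat_of_poly q.
Proof. exact: tofracD. Qed.

Lemma rat_of_polyB p q : rat_of_poly (p - q) = rat_of_poly p - rat_of_poly q.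
Proof. exact: tofracB. Qed.

Lemma rat_of_polyM p q : rat_of_poly (p * q) = rat_of_poly p * rat_of_poly q.
Proof. exact: tofracM. Qed.

Lemma ratfunP f : exists p q, q != 0 /\ f = rat_of_poly p / rat_of_poly q.
Proof.
by exists \n_(repr f), \d_(repr f); split; [exact: denom_ratioP|exact: fraction_repr].
Qed.

Lemma rat_div_eq p q r s : q != 0 -> s != 0 ->
  (rat_of_poly p / rat_of_poly q == rat_of_poly r / rat_of_poly s) = (p * s == r * q).
Proof.
move=> q0 s0; rewrite eqr_div ?rat_of_poly_eq0 //.
by rewrite -!rat_of_polyM (inj_eq rat_of_poly_inj).
Qed.

(** Links the fraction picked by [repr] to an explicit quotient, so that definitions through [repr]
    can be evaluated on any quotient. *)
Lemma ratfun_repr p q : q != 0 ->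
  \n_(repr (rat_of_poly p / rat_of_poly q)) * q =
  p * \d_(repr (rat_of_poly p / rat_of_poly q)).
Proof.
set f := _ / _ => q0; apply/eqP; rewrite -rat_div_eq ?denom_ratioP //.
by rewrite eq_sym; apply/eqP; rewrite -/f; exact: fraction_repr.
Qed.

End Fraction.

(** * Derivations of the field of rational functions *)

Section Derivation.

Variables (F : fieldType) (m : nat).
Implicit Types (f h : ratfun F m) (p q r s : {mpoly F[m]}).

(** The quotient rule does not depend on the fraction: primes stand for derivatives, and the second
    hypothesis is the derivative of the first. *)
Lemma quotient_rule_unique (R : comPzRingType) (a b a' b' c d c' d' : R) :
  a * d = c * b -> a' * d + a * d' = c' * b + c * b' ->
  (a' * b - a * b') * d ^+ 2 = (c' * d - c * d') * b ^+ 2.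
Proof.
move=> e e'; have -> : (a' * b - a * b') * d ^+ 2 =
  (a' * d + a * d') * b * d - (a * d) * (b * d' + b' * d) by ring.
by rewrite e' e; ring: e.
Qed.

Lemma rat_deriv_div i p q : q != 0 -> rat_deriv i (rat_of_poly p / rat_of_poly q) =
  rat_of_poly (mderiv i p * q - p * mderiv i q) / rat_of_poly (q ^+ 2).
Proof.
move=> q0; apply/eqP; rewrite rat_div_eq ?expf_neq0 ?denom_ratioP //.
have e := ratfun_repr p q0; have := congr1 (mderiv i) e; rewrite !mderivM => e'.
by apply/eqP; apply: quotient_rule_unique.
Qed.

Lemma rat_deriv_poly i p : rat_deriv i (rat_of_poly p) = rat_of_poly (mderiv i p).
Proof.
have r1 : rat_of_poly (1 : {mpoly F[m]}) = 1 by exact: tofrac1.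
have := rat_deriv_div i p (oner_neq0 {mpoly F[m]}).
rewrite expr1n r1 !divr1 => ->; congr rat_of_poly.
by rewrite -mpolyC1 mderivC mulr0 subr0 mulr1.
Qed.

Lemma quotient_rule_add (K : fieldType) (a b a' b' c d c' d' : K) : b != 0 -> d != 0 ->
  (((a' * d + a * d') + (c' * b + c * b')) * (b * d) -
     (a * d + c * b) * (b' * d + b * d')) / (b * d) ^+ 2 =
  (a' * b - a * b') / b ^+ 2 + (c' * d - c * d') / d ^+ 2.
Proof. by move=> b0 d0; field; rewrite b0 d0. Qed.

Lemma quotient_rule_mul (K : fieldType) (a b a' b' c d c' d' : K) : b != 0 -> d != 0 ->
  ((a' * c + a * c') * (b * d) - (a * c) * (b' * d + b * d')) / (b * d) ^+ 2 =
  (a' * b - a * b') / b ^+ 2 * (c / d) + a / b * ((c' * d - c * d') / d ^+ 2).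
Proof. by move=> b0 d0; field; rewrite b0 d0. Qed.

Lemma rat_derivD i f h : rat_deriv i (f + h) = rat_deriv i f + rat_deriv i h.
Proof.
have [a [b [b0 ->]]] := ratfunP f; have [c [d [d0 ->]]] := ratfunP h.
have B0 : rat_of_poly b != 0 by rewrite rat_of_poly_eq0.
have D0 : rat_of_poly d != 0 by rewrite rat_of_poly_eq0.
rewrite (addf_div (rat_of_poly a) (rat_of_poly c) B0 D0).
rewrite -(rat_of_polyM b d) -(rat_of_polyM a d) -(rat_of_polyM c b).
rewrite -(rat_of_polyD (a * d)) (rat_deriv_div i a b0) (rat_deriv_div i c d0).
rewrite rat_deriv_div ?mulf_neq0 //.
rewrite mderivD !mderivM !expr2.
rewrite !(rat_of_polyB, rat_of_polyM, rat_of_polyD) -!expr2.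
exact: (quotient_rule_add (rat_of_poly a) (rat_of_poly (mderiv i a))
  (rat_of_poly (mderiv i b)) (rat_of_poly c) (rat_of_poly (mderiv i c))
  (rat_of_poly (mderiv i d)) B0 D0).
Qed.

Lemma rat_derivM i f h : rat_deriv i (f * h) = rat_deriv i f * h + f * rat_deriv i h.
Proof.
have [a [b [b0 ->]]] := ratfunP f; have [c [d [d0 ->]]] := ratfunP h.
have B0 : rat_of_poly b != 0 by rewrite rat_of_poly_eq0.
have D0 : rat_of_poly d != 0 by rewrite rat_of_poly_eq0.
rewrite (mulf_div (rat_of_poly a)) -(rat_of_polyM b d) -(rat_of_polyM a c).
rewrite (rat_deriv_div i a b0) (rat_deriv_div i c d0) rat_deriv_div ?mulf_neq0 //.
rewrite !mderivM !expr2.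
rewrite !(rat_of_polyB, rat_of_polyM, rat_of_polyD) -!expr2.
exact: (quotient_rule_mul (rat_of_poly a) (rat_of_poly (mderiv i a))
  (rat_of_poly (mderiv i b)) (rat_of_poly c) (rat_of_poly (mderiv i c))
  (rat_of_poly (mderiv i d)) B0 D0).
Qed.

Lemma rat_derivm_poly al p : rat_derivm al (rat_of_poly p) = rat_of_poly (mderivm al p).
Proof.
rewrite /rat_derivm /mderivm; elim: (enum _) => //= i s ->.
by elim: (al i) => //= k ->; exact: rat_deriv_poly.
Qed.

End Derivation.

Lemma subf_div (K : fieldType) (x z y t : K) : y != 0 -> t != 0 ->
  x / y - z / t = (x * t - z * y) / (y * t).
Proof. by move=> y0 t0; rewrite -mulNr addf_div // mulNr. Qed.

(** * The group action on rational functions *)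

Section Action.

Variables (F : closedFieldType) (n m : nat).
Variables (G : set 'M[F]_n) (rho : 'M[F]_n -> 'M[F]_m).
Hypotheses (hG : algebraic_group G) (hrho : rational_rep G rho).
Implicit Types (f h : ratfun F m) (p q : {mpoly F[m]}).

Lemma poly_act_eq0 g p : G g -> (poly_act rho g p == 0) = (p == 0).
Proof.
move=> hg; apply/eqP/eqP => [e|->]; last exact: rmorph0.
by rewrite -(poly_actK hG hrho p hg) e; exact: rmorph0.
Qed.

Lemma rat_act_div g p q : G g -> q != 0 -> rat_act rho g (rat_of_poly p / rat_of_poly q) =
  rat_of_poly (poly_act rho g p) / rat_of_poly (poly_act rho g q).
Proof.
move=> hg q0; apply/eqP; rewrite rat_div_eq ?poly_act_eq0 ?denom_ratioP //.
by rewrite -!poly_actM (ratfun_repr p q0).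
Qed.

Lemma rat_act_poly g p : G g -> rat_act rho g (rat_of_poly p) = rat_of_poly (poly_act rho g p).
Proof.
move=> hg; have r1 : rat_of_poly (1 : {mpoly F[m]}) = 1 by exact: tofrac1.
have := rat_act_div p hg (oner_neq0 {mpoly F[m]}).
by rewrite (_ : poly_act rho g 1 = 1) ?r1 ?divr1 //; exact: rmorph1.
Qed.

Lemma rat_actM g f h : G g -> rat_act rho g (f * h) = rat_act rho g f * rat_act rho g h.
Proof.
move=> hg.
have [a [b [b0 ->]]] := ratfunP f; have [c [d [d0 ->]]] := ratfunP h.
by rewrite mulf_div -!rat_of_polyM !rat_act_div ?mulf_neq0 // !poly_actM mulf_div -!rat_of_polyM.
Qed.

Lemma rat_actB g f h : G g -> rat_act rho g (f - h) = rat_act rho g f - rat_act rho g h.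
Proof.
move=> hg.
have [a [b [b0 ->]]] := ratfunP f; have [c [d [d0 ->]]] := ratfunP h.
have B0 : rat_of_poly b != 0 by rewrite rat_of_poly_eq0.
have D0 : rat_of_poly d != 0 by rewrite rat_of_poly_eq0.
have gB0 : rat_of_poly (poly_act rho g b) != 0 by rewrite rat_of_poly_eq0 poly_act_eq0.
have gD0 : rat_of_poly (poly_act rho g d) != 0 by rewrite rat_of_poly_eq0 poly_act_eq0.
rewrite (rat_act_div a hg b0) (rat_act_div c hg d0).
rewrite (subf_div (rat_of_poly a) (rat_of_poly c) B0 D0).
rewrite -(rat_of_polyM a d) -(rat_of_polyM c b) -(rat_of_polyM b d) -rat_of_polyB.
rewrite rat_act_div ?mulf_neq0 //.
have -> : poly_act rho g (a * d - c * b) =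
    poly_act rho g a * poly_act rho g d - poly_act rho g c * poly_act rho g b.
  by rewrite -!poly_actM; exact: rmorphB.
rewrite poly_actM rat_of_polyB !rat_of_polyM.
by rewrite (subf_div (rat_of_poly _) (rat_of_poly _) gB0 gD0).
Qed.

Lemma rat_actK g f : G g -> rat_act rho (invmx g) (rat_act rho g f) = f.
Proof.
move=> hg; have [a [b [b0 ->]]] := ratfunP f.
have hg' := group_inv hG hg.
by rewrite !rat_act_div ?poly_act_eq0 // !(poly_actK hG hrho).
Qed.

Lemma rat_actVK g f : G g -> rat_act rho g (rat_act rho (invmx g) f) = f.
Proof. by move=> hg; have := rat_actK f (group_inv hG hg); rewrite invmxK. Qed.

End Action.

(** * Differential operators *)

Section DifferentialOrder.

Variables (K : fieldType) (S : set K).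
Implicit Types (E : K -> K) (d : nat).

(* Grothendieck's description of the operators of order less than [d]: their
   iterated commutators with [d] multiplications by elements of [S] vanish. *)
Fixpoint order_below d E : Prop :=
  if d is d'.+1 then forall s, S s -> order_below d' (fun f => E (s * f) - s * E f)
  else forall f, E f = 0.

Lemma eq_order_below d E E' : E =1 E' -> order_below d E -> order_below d E'.
Proof. by move=> /funext ->. Qed.

Lemma order_belowD d E E' : order_below d E -> order_below d E' ->
  order_below d (fun f => E f + E' f).
Proof.
elim: d E E' => [|d IH] E E' /= h h'; first by move=> f; rewrite h h' addr0.
move=> s Ss; apply: eq_order_below (IH _ _ (h s Ss) (h' s Ss)) => f.
by rewrite mulrDr opprD addrACA.
Qed.

Lemma order_belowZ d c E : order_below d E -> order_below d (fun f => c * E f).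
Proof.
elim: d E => [|d IH] E /= h; first by move=> f; rewrite h mulr0.
move=> s Ss; apply: eq_order_below (IH _ (h s Ss)) => f.
by rewrite mulrBr (mulrCA c).
Qed.

Lemma order_belowS d E : order_below d E -> order_below d.+1 E.
Proof.
elim: d E => [|d IH] E h s Ss.
  by move=> f; rewrite !h mulr0 subrr.
by apply: IH; exact: h.
Qed.

Lemma order_below_leq d e E : (d <= e)%N -> order_below d E -> order_below e E.
Proof.
move=> /subnKC <-; elim: (e - d)%N => [|k IH] h; first by rewrite addn0.
by rewrite addnS; apply: order_belowS; exact: IH.
Qed.

Lemma order_below_id : order_below 1 id.
Proof. by move=> s _ f; rewrite subrr. Qed.

(** The commutator of [D \o E] with [s] is [D] composed with the commutator of [E], plus [D s] times
    [E]. *)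
Lemma order_below_derivation (D : K -> K) d E :
  {morph D : x y / x + y} -> (forall x y, D (x * y) = D x * y + x * D y) ->
  order_below d E -> order_below d.+1 (D \o E).
Proof.
move=> DD DM; elim: d E => [|d IH] E h s Ss.
  have D0 : D 0 = 0 by apply: (addrI (D 0)); rewrite -DD !addr0.
  by move=> f /=; rewrite !h D0 mulr0 subrr.
have := order_belowD (IH _ (h s Ss)) (order_belowZ (D s) h).
apply: eq_order_below => f /=.
have -> : D (E (s * f)) = D (E (s * f) - s * E f) + D (s * E f) by rewrite -DD subrK.
by rewrite DM addrA addrK.
Qed.

(** The commutator of the conjugate with [s] is the conjugate of the commutator of [E] with
    [tau s]. *)
Lemma order_below_conj (sigma tau : K -> K) d E :
  {morph sigma : x y / x - y} -> {morph sigma : x y / x * y} ->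
  {morph tau : x y / x * y} -> cancel tau sigma -> (forall s, S s -> S (tau s)) ->
  order_below d E -> order_below d (fun f => sigma (E (tau f))).
Proof.
move=> sB sM tM tK tS; elim: d E => [|d IH] E /= h.
  have s0 : sigma 0 = 0 by rewrite -[in LHS](subrr 0) sB subrr.
  by move=> f; rewrite h s0.
move=> s Ss; apply: eq_order_below (IH _ (h _ (tS s Ss))) => f /=.
by rewrite sB sM tM tK.
Qed.

(** The commutators of [E] also vanish on [S], hence everywhere by induction. So [E] commutes with
    multiplication by [q], and [q * E (p / q) = E p = 0]. *)
Lemma order_below_vanish d E :
  (forall f, exists p q, [/\ S p, S q, q != 0 & f = p / q]) ->
  (forall p q, S p -> S q -> S (p * q)) ->
  order_below d E -> (forall p, S p -> E p = 0) -> forall f, E f = 0.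
Proof.
move=> fracS SM; elim: d E => [|d IH] E h E0 f; first exact: h.
have [p [q [Sp Sq q0 ->]]] := fracS f.
have comm r : S r -> E (q * r) - q * E r = 0.
  by move=> Sr; rewrite !E0 ?mulr0 ?subr0 //; exact: SM.
have := IH _ (h q Sq) comm (p / q).
rewrite mulrC divfK // E0 // sub0r => /eqP.
by rewrite oppr_eq0 mulf_eq0 (negbTE q0) => /eqP.
Qed.

End DifferentialOrder.

(** * Order and coefficients of differential operators *)

Section DiffOp.

Variables (F : closedFieldType) (m : nat).
Local Notation ratfun := (ratfun F m).
Local Notation poly_ring := (@polynomial_ring F m).

Lemma order_below_rat_derivm (al : 'X_{1..m}) :
  exists d, order_below poly_ring d (@rat_derivm F m al).
Proof.
rewrite /rat_derivm; elim: (enum _) => [|i s [d hd]] /=.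
  by exists 1%N; exact: order_below_id.
elim: (al i) => [|k [e he]]; first by exists d.
exists e.+1.
exact: (order_below_derivation (@rat_derivD F m i) (@rat_derivM F m i) he).
Qed.

Lemma order_below_diff_op A D : diff_op A D -> exists d, order_below poly_ring d D.
Proof.
move=> [a [_ /funext ->]]; elim: (msupp a) => [|al s [d hd]].
  by exists 0%N => f; rewrite big_nil.
have [e he] := order_below_rat_derivm al.
exists (maxn e d); have := order_belowD
  (order_below_leq (leq_maxl e d) (order_belowZ (a@_al) he))
  (order_below_leq (leq_maxr e d) hd).
by apply: eq_order_below => f; rewrite big_cons.
Qed.

Lemma poly_ring_of p : poly_ring (rat_of_poly p).
Proof. by exists p. Qed.

Lemma poly_ringM f h : poly_ring f -> poly_ring h -> poly_ring (f * h).
Proof. by move=> [p _ <-] [q _ <-]; rewrite -rat_of_polyM; exact: poly_ring_of. Qed.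

Lemma poly_ringB f h : poly_ring f -> poly_ring h -> poly_ring (f - h).
Proof. by move=> [p _ <-] [q _ <-]; rewrite -rat_of_polyB; exact: poly_ring_of. Qed.

Lemma poly_ringD f h : poly_ring f -> poly_ring h -> poly_ring (f + h).
Proof. by move=> [p _ <-] [q _ <-]; rewrite -rat_of_polyD; exact: poly_ring_of. Qed.

Lemma poly_ring0 : poly_ring 0.
Proof. by exists 0 => //; exact: tofrac0. Qed.

Lemma poly_ring_sum (I : Type) (s : seq I) (P : pred I) (f : I -> ratfun) :
  (forall i, P i -> poly_ring (f i)) -> poly_ring (\sum_(i <- s | P i) f i).
Proof. by move=> h; apply: big_ind => //; [exact: poly_ring0|exact: poly_ringD]. Qed.

(* The coefficient of [al] is read off the value at ['X_[al]], the other terms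
   of which only involve coefficients of lower degree. *)
Lemma diff_op_poly_coef (a : {mpoly ratfun[m]}) :
  (forall k, (0 < k)%N -> k%:R != 0 :> F) ->
  (forall p, poly_ring (\sum_(al <- msupp a) a@_al * rat_derivm al (rat_of_poly p))) ->
  forall al, poly_ring a@_al.
Proof.
move=> char0 h al; have [k] := ubnP (mdeg al); elim: k al => // k IH al; rewrite ltnS => le.
have [as_|/memN_msupp_eq0 ->] := boolP (al \in msupp a); last exact: poly_ring0.
have := h 'X_[al]; rewrite (bigD1_seq al) //= => hsum.
(* The factorial of the multi-index [al], which is the derivative of ['X_[al]] along [al];
   characteristic 0 makes it invertible. *)
pose c : F := (\prod_(i < m) (al i) ^_ (al i))%:R.
have c0 : c != 0 by apply: char0; apply: prodn_gt0 => i; rewrite ffactnn fact_gt0.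
have hrest : poly_ring (\sum_(be <- msupp a | be != al)
    a@_be * rat_derivm be (rat_of_poly 'X_[al])).
  apply: poly_ring_sum => be ne; rewrite rat_derivm_poly mderivmX.
  (* A multi-index strictly below [al] has smaller degree; one not below [al] kills the monomial. *)
  have [le_be|nle] := boolP (be <= al)%MM.
    apply: poly_ringM; last exact: poly_ring_of.
    apply: IH; apply: leq_trans le.
    rewrite -(submK le_be) mdegD -[X in (X < _)%N]add0n ltn_add2r lt0n mdeg_eq0.
    apply: contra ne => /eqP e.
    by rewrite -(submK le_be) e add0m.
  move/mnm_lepP/existsNP: nle => [i /negP]; rewrite -ltnNge => lt.
  rewrite (bigD1 i) //= ffact_small // mul0n scale0r.
  by exists 0 => //; rewrite /rat_of_poly tofrac0 mulr0.
have := poly_ringB hsum hrest; rewrite addrK rat_derivm_poly mderivmX -/c.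
have -> : (al - al = 0)%MM by apply/mnmP => i; rewrite mnmBE mnm0E subnn.
rewrite mpolyX0.
move=> /poly_ringM /(_ (poly_ring_of (c^-1%:MP))).
rewrite -mulrA -rat_of_polyM -mul_mpolyC mulr1 -mpolyCM divff //.
by rewrite /rat_of_poly mpolyC1 tofrac1 mulr1.
Qed.

End DiffOp.

(** * Comparison of the invariant operators over the two rings *)

Section Main.

Variables (F : closedFieldType) (n m r : nat).
Variables (G : set 'M[F]_n) (rho : 'M[F]_n -> 'M[F]_m) (Delta : 'I_r -> {mpoly F[m]}).
Hypotheses (hG : algebraic_group G) (hrho : rational_rep G rho).

Local Notation ratfun := (ratfun F m).
Local Notation poly_ring := (@polynomial_ring F m).

Lemma poly_ring_sub_regular : poly_ring `<=` regular_ring Delta.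
Proof.
move=> _ [p _ <-]; exists p, (fun=> 0%N).
by rewrite big1 // /rat_of_poly tofrac1 divr1.
Qed.

(** [D] and its conjugate by [g] both have finite order and agree on polynomials, so their
    difference vanishes on all rational functions. *)
Lemma invariant_diff_op_extends A D :
  poly_ring `<=` A -> invariant_diff_op G rho poly_ring D ->
  invariant_diff_op G rho A D.
Proof.
move=> sA [hD hinv]; split.
  by have [a [ha hDa]] := hD; exists a; split=> // al; exact: sA.
move=> g f hg _; have hg' := group_inv hG hg; have [d hd] := order_below_diff_op hD.
have poly_act_ring h : G h -> forall q, poly_ring q -> poly_ring (rat_act rho h q).
  by move=> hh _ [p _ <-]; rewrite (rat_act_poly hG hrho) //; exact: poly_ring_of.
have hc : order_below poly_ring d (fun q => rat_act rho g (D (rat_act rho (invmx g) q))).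
  apply: order_below_conj hd.
  - by move=> p q; exact: (rat_actB hG hrho).
  - by move=> p q; exact: (rat_actM hG hrho).
  - by move=> p q; exact: (rat_actM hG hrho).
  - by move=> q; exact: (rat_actVK hG hrho).
  - exact: poly_act_ring.
apply/eqP; rewrite -subr_eq0; apply/eqP.
have := order_below_vanish _ _ (order_belowD hc (order_belowZ (-1) hd)).
move=> /(_ _ _ _ f); rewrite mulN1r; apply.
- move=> q; have [a [b [b0 ->]]] := ratfunP q.
  exists (rat_of_poly a), (rat_of_poly b).
  by split=> //; [exact: poly_ring_of|exact: poly_ring_of|rewrite rat_of_poly_eq0].
- exact: poly_ringM.
by move=> q hq; rewrite mulN1r hinv // subrr.
Qed.

Hypotheses (hconn : zconnected G) (hmf : multiplicity_free G rho)
  (hDelta : fundamental_relative_invariants G rho Delta).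

Lemma Delta_prod_neq0 (e : 'I_r -> nat) : \prod_(i < r) Delta i ^+ e i != 0.
Proof. by apply/prodf_neq0 => i _; apply: expf_neq0; case: hDelta => /(_ i) []. Qed.

Lemma common_denominator (a : {mpoly ratfun[m]}) (s : seq 'X_{1..m}) :
  (forall al, regular_ring Delta a@_al) ->
  exists e : 'I_r -> nat, forall al, al \in s ->
    poly_ring (rat_of_poly (\prod_(i < r) Delta i ^+ e i) * a@_al).
Proof.
move=> ha; elim: s => [|al s [e he]]; first by exists (fun=> 0%N).
have [p [e' ep]] := ha al; exists (fun i => e i + e' i)%N => be.
have -> : \prod_(i < r) Delta i ^+ (e i + e' i) =
    \prod_(i < r) Delta i ^+ e i * \prod_(i < r) Delta i ^+ e' i.
  by rewrite -big_split; apply: eq_bigr => i _; rewrite exprD.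
rewrite rat_of_polyM inE => /orP[/eqP ->|bs].
  rewrite ep -mulrA; apply: poly_ringM; first exact: poly_ring_of.
  by rewrite mulrC divfK ?rat_of_poly_eq0 ?Delta_prod_neq0 //; exact: poly_ring_of.
by rewrite mulrAC; apply: poly_ringM; [exact: he|exact: poly_ring_of].
Qed.

Lemma regular_invariant_preserves_poly D :
  invariant_diff_op G rho (regular_ring Delta) D ->
  forall p, poly_ring (D (rat_of_poly p)).
Proof.
move=> [[a [ha hD]] hinv].
have [e he] := common_denominator (msupp a) ha.
set P := \prod_(i < r) _ in he; have P0 : P != 0 by exact: Delta_prod_neq0.
have relP : relative_invariant G rho P.
  apply: relative_invariant_prod => // i.
  exact: (fundamental_relative_invariant hG hrho hconn hDelta).
(* The scalar is chosen for every matrix, with the default value 0 outside [G]. *)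
have /choice [chi hchi] : forall g, exists c, G g -> poly_act rho g P = c *: P.
  by move=> g; have [/relP [c hc]|ng] := pselect (G g); [exists c|exists 0 => /ng].
have chi0 g : G g -> chi g != 0.
  move=> hg; apply: contra_neq P0 => c0; apply/eqP.
  by rewrite -(poly_act_eq0 hG hrho P hg) hchi // c0 scale0r.
have /choice [T hT] : forall p, exists q, rat_of_poly q = rat_of_poly P * D (rat_of_poly p).
  move=> p; suff [q _ eq] : poly_ring (rat_of_poly P * D (rat_of_poly p)) by exists q.
  rewrite hD mulr_sumr big_seq; apply: poly_ring_sum => al hal.
  rewrite mulrA rat_derivm_poly; apply: poly_ringM; last exact: poly_ring_of.
  exact: he.
have D_linear (c : F) p q : D (rat_of_poly (c *: p + q)) =
    rat_of_poly c%:MP * D (rat_of_poly p) + D (rat_of_poly q).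
  rewrite !hD mulr_sumr -big_split; apply: eq_bigr => al _ /=.
  rewrite !rat_derivm_poly mderivmD mderivmZ -mul_mpolyC rat_of_polyD rat_of_polyM.
  by rewrite mulrDr (mulrCA (rat_of_poly c%:MP)).
have lin2 (c : F) p q : T (c *: p + q) = c *: T p + T q.
  apply: rat_of_poly_inj; rewrite hT D_linear mulrDr -mul_mpolyC rat_of_polyD rat_of_polyM.
  by rewrite !hT (mulrCA (rat_of_poly c%:MP)).
have [I [U [dU irrU isoU]]] := hmf.
have DU i p : U i p -> poly_ring (D (rat_of_poly p)).
  move=> Up; have [sU U0 _] := irrU i; have [U00 _ _] := sU.
  (* This inclusion turns [P * D p] into [P * q] with [q] in [U i], and cancelling [P] gives
     [D p = q]. *)
  have TU : T @` U i `<=` (fun q => P * q) @` U i.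
    apply: (multiplicity_free_image hmf (irrU i) chi0).
    - by move=> c q q' _ _; rewrite mulrDr -scalerAr.
    - by move=> c q q' _ _; exact: lin2.
    - by move=> g q hg _; rewrite poly_actM hchi // scalerAl.
    - move=> g q hg _; apply: rat_of_poly_inj.
      rewrite -(rat_act_poly hG hrho) // hT (rat_actM hG hrho) // (rat_act_poly hG hrho) //.
      rewrite hchi // -!mul_mpolyC !rat_of_polyM hT -mulrA; congr (_ * (_ * _)).
      (* Invariance of [D] at the transform of [q] shows that [D] commutes with [g], so the only
         twist comes from [P]. *)
      rewrite -(hinv g (rat_of_poly (poly_act rho g q))) //; last exact/poly_ring_sub_regular/poly_ring_of.
      by rewrite -(rat_act_poly hG hrho q hg) (rat_actK hG hrho).
    apply: contrapT => h; apply: U0; apply/seteqP; split=> [q Uq|_ ->] //.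
    apply: contrapT => q0; apply: h; exists q => // /eqP.
    by rewrite mulf_eq0 (negbTE P0) => /eqP.
  have [q Uq e'] := TU (T p) (ex_intro2 _ _ p Up erefl).
  have := hT p; rewrite -e' rat_of_polyM => /mulfI <-; first exact: poly_ring_of.
  by rewrite rat_of_poly_eq0.
move=> p; have [dec _] := dU; have [s [u [hu ->]]] := dec p.
elim: s => [|i s IH].
  have /eqP := D_linear 1 0 0; rewrite scale1r addr0 /rat_of_poly mpolyC1 tofrac1 mul1r.
  by rewrite -subr_eq subrr eq_sym big_nil => /eqP ->; exact: poly_ring0.
rewrite big_cons -[u i]scale1r D_linear; apply: poly_ringD => //.
by apply: poly_ringM; [exact: poly_ring_of|exact: DU].
Qed.

End Main.

Theorem theorem2p2p6 (R : realType) (n m r : nat)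
    (G : set 'M[R[i]]_n) (rho : 'M[R[i]]_n -> 'M[R[i]]_m)
    (Delta : 'I_r -> {mpoly R[i][m]})
    (hG : algebraic_group G) (hconn : zconnected G) (hred : reductive G)
    (hrho : rational_rep G rho) (hmf : multiplicity_free G rho)
    (hDelta : fundamental_relative_invariants G rho Delta) :
  invariant_diff_op G rho (@polynomial_ring R[i] m) =
  invariant_diff_op G rho (regular_ring Delta).
Proof.
apply/seteqP; split=> D hD.
  exact: (invariant_diff_op_extends hG hrho (@poly_ring_sub_regular _ _ _ Delta)).
have hpoly := regular_invariant_preserves_poly hG hrho hconn hmf hDelta hD.
have [[a [ha hDa]] hinv] := hD; split.
  (* The same symbol [a] serves over both rings: since [D] preserves polynomials, its coefficients
     are polynomials. *)
  exists a; split=> //; apply: diff_op_poly_coef => [k k0|p].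
    by rewrite Num.Theory.pnatr_eq0 -lt0n.
  by have := hpoly p; rewrite hDa.
by move=> g f hg hf; apply: hinv => //; exact: poly_ring_sub_regular.
Qed.
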